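(* A chordal graph $G$ is a substar graph if and only if $G$ has no induced subgraph isomorphic to a graph in the family $\mathcal{S}$, where $\mathcal{S}$ consists of the following graphs. (1) The graph $H_1$ with vertex set $\{w,x,a,y,b,z\}$ and edge set $\{ax, xw, wy, yb\}\cup\{za,zx,zw,zy,zb\}$. (2) The graphs of type $H_2$: each has vertex set $\{u,x,a,v,y,b,z\}$, contains the edges $ux, xa, vy, yb$ and $zu,zx,za,zv,zy,zb$, and in addition, among the pairs $uv, uy, ub, vx, va$, exactly one of the following sets of edges: (i) none of them; (ii) exactly $uv, vx, va$; (iii) all of $uv,uy,ub,vx,va$. There are no other edges. (3) For every integer $k\ge 3$, the graph $H_3^k$ with vertex set $\{u,v,c_1,\ldots,c_{k-1},a_1,\ldots,a_k\}$ and edge set $$\left(\binom{\{u,v,c_1,\ldots,c_{k-1}\}}{2}\cup\{ua_1, va_k\}\cup\bigcup_{i=1}^{k-1}\{a_ic_i, c_ia_{i+1}\}\right)\setminus\{uv\}.$$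
   Context: A graph is chordal if it has no induced cycle of length at least four. A star is a tree containing a vertex adjacent to all other vertices of the tree (a single vertex counts as a star). A graph $G$ is a substar graph if there exist a tree $T$ and an assignment to each vertex $v$ of $G$ of a subtree $f(v)$ of $T$ that is a star, such that two distinct vertices $x,y$ of $G$ are adjacent if and only if $f(x)$ and $f(y)$ share a vertex of $T$. $\binom{X}{2}$ denotes the set of all 2-element subsets of $X$. *)

(* Defs.v *)
From mathcomp Require Import all_boot.

Set Implicit Arguments.
Unset Strict Implicit.
Unset Printing Implicit Defensive.

(* Finite simple graphs. *)
Record sgraph := SGraph {
  vertex :> finType;
  adj : rel vertex;
  adj_sym : symmetric adj;
  adj_irrefl : irreflexive adj
}.

Section MkGraph.
Variables (V : finType) (r : rel V).

(* The pairs related by r, taken as unordered edges without loops. *)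
Definition sym_rel : rel V := fun x y => (x != y) && (r x y || r y x).

Fact sym_rel_sym : symmetric sym_rel.
Proof. by move=> x y; rewrite /sym_rel eq_sym orbC. Qed.

Fact sym_rel_irrefl : irreflexive sym_rel.
Proof. by move=> x; rewrite /sym_rel eqxx. Qed.

Definition mk_graph : sgraph := SGraph sym_rel_sym sym_rel_irrefl.
End MkGraph.

Section Induced.
Variables (G : sgraph) (S : {set G}).

Definition induced_adj : rel {x : G | x \in S} :=
  fun x y => adj (val x) (val y).

Fact induced_adj_sym : symmetric induced_adj.
Proof. by move=> x y; apply: adj_sym. Qed.

Fact induced_adj_irrefl : irreflexive induced_adj.
Proof. by move=> x; apply: adj_irrefl. Qed.

Definition induced : sgraph := SGraph induced_adj_sym induced_adj_irrefl.
End Induced.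

Definition isomorphic (G H : sgraph) : Prop :=
  exists2 f : G -> H, bijective f & forall x y, adj (f x) (f y) = adj x y.

Definition has_induced (G H : sgraph) : Prop :=
  exists S : {set G}, isomorphic (induced S) H.

(* The cycle 0, 1, ..., n-1, 0; only meaningful for n >= 3. *)
Definition cycle_graph (n : nat) : sgraph :=
  mk_graph (fun i j : 'I_n => ordS i == j).

Definition chordal (G : sgraph) : Prop :=
  forall n, 4 <= n -> ~ has_induced G (cycle_graph n).

Definition connected (G : sgraph) : Prop :=
  forall x y : G, connect (@adj G) x y.

(* The size bound is needed because x, y, x is a ucycle along a single edge. *)
Definition acyclic (G : sgraph) : Prop :=
  forall s : seq G, 2 < size s -> ~ ucycle (@adj G) s.

Definition tree (G : sgraph) : Prop :=
  [/\ 0 < #|G|, connected G & acyclic G].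

Definition star (G : sgraph) : Prop :=
  tree G /\ exists c : G, forall x : G, x != c -> adj c x.

(* A subtree of a tree is the subgraph induced by its vertex set, so it is
   represented by that set. *)
Definition substar (G : sgraph) : Prop :=
  exists (T : sgraph) (f : G -> {set T}),
    [/\ tree T,
        forall v, star (induced (f v))
      & forall x y, x != y -> (adj x y <-> exists t, t \in f x :&: f y)].

Definition edge_graph (n : nat) (E : seq (nat * nat)) : sgraph :=
  mk_graph (fun i j : 'I_n => (val i, val j) \in E).

Definition H1 : sgraph :=
  let w := 0 in let x := 1 in let a := 2 in
  let y := 3 in let b := 4 in let z := 5 in
  edge_graph 6
    ([:: (a, x); (x, w); (w, y); (y, b)] ++
     [:: (z, a); (z, x); (z, w); (z, y); (z, b)]).

Variant H2_type := H2_i | H2_ii | H2_iii.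

Definition H2 (t : H2_type) : sgraph :=
  let u := 0 in let x := 1 in let a := 2 in
  let v := 3 in let y := 4 in let b := 5 in let z := 6 in
  edge_graph 7
    ([:: (u, x); (x, a); (v, y); (y, b)] ++
     [:: (z, u); (z, x); (z, a); (z, v); (z, y); (z, b)] ++
     match t with
     | H2_i => [::]
     | H2_ii => [:: (u, v); (v, x); (v, a)]
     | H2_iii => [:: (u, v); (u, y); (u, b); (v, x); (v, a)]
     end).

(* inl i is c_i, with c_0 = u and c_k = v; inr j is a_(j+1). With these names,
   a_i is adjacent to c_(i-1) and c_i for all 1 <= i <= k. *)
Definition H3 (k : nat) : sgraph :=
  mk_graph (fun p q : 'I_k.+1 + 'I_k =>
    match p, q with
    | inl i, inl j => (i < j) && ~~ ((val i == 0) && (val j == k))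
    | inl i, inr j => (val i == val j) || (val i == (val j).+1)
    | _, _ => false
    end).

Variant family_S : sgraph -> Prop :=
  | S_H1 : family_S H1
  | S_H2 t : family_S (H2 t)
  | S_H3 k : 3 <= k -> family_S (H3 k).

(* Main.v *)
(* In a substar representation choose a center for each star. If an edge xy has
   two nonadjacent common neighbours, then the center of x lies in the star of
   y; if it has three pairwise nonadjacent ones, then x and y have the same
   center. Each graph of the family S contains a path x, c_0, ..., c_n, y with
   x, y nonadjacent whose end edges are of the first kind and whose inner edges
   are of the second kind, so the common center of the c_i would lie in the
   stars of both x and y.
   Conversely, let G be chordal. Call an edge weak if it lies in at least two
   maximal cliques and strong if it lies in at least three, and call a violation
   a path x, c_0, ..., c_n, y with x, y nonadjacent, end edges weak and inner
   edges strong. A shortest violation yields H_1 or H_2 for n = 0, and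
   H_3^(n+2) for n > 0. If there is no violation, then all weak neighbours of a
   component of the strong edges lie in one maximal clique, which serves as the
   center of all vertices of this component. The edges joining the center of v
   to the other maximal cliques containing v, for all v, then form a forest. *)

Require Import Defs.
From mathcomp Require Import all_boot zify.

Set Implicit Arguments.
Unset Strict Implicit.
Unset Printing Implicit Defensive.

(** * Induced subgraphs as embeddings *)

Lemma has_induced_embed (G H : sgraph) (e : H -> G) :
  injective e -> (forall x y, adj (e x) (e y) = adj x y) -> has_induced G H.
Proof.
move=> e_inj e_adj; pose S := [set e x | x : H].
have eS x : e x \in S by apply: imset_f.
pose g x : induced S := exist _ (e x) (eS x).
have g_bij : bijective g.
  apply: inj_card_bij => [x y [/e_inj] //|].
  by rewrite card_sig -[#|H|](card_imset H e_inj).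
exists S; have [f gK fK] := g_bij.
exists f => [|x y]; first by exists g.
by rewrite -e_adj -[in RHS](fK x) -[in RHS](fK y).
Qed.

Lemma has_induced_embedding (G H : sgraph) :
  has_induced G H ->
  exists2 e : H -> G, injective e & forall x y, adj (e x) (e y) = adj x y.
Proof.
case=> S [f [g fK gK] f_adj]; exists (fun x => val (g x)).
  by move=> x y /val_inj /(can_inj gK).
by move=> x y; rewrite -[in RHS](gK x) -[in RHS](gK y) f_adj.
Qed.

Lemma substar_induced (G H : sgraph) :
  substar G -> has_induced G H -> substar H.
Proof.
move=> [T [f [treeT star_f f_adj]]] /has_induced_embedding[e e_inj e_adj].
exists T, (fun x => f (e x)); split=> // x y xy.
by rewrite -e_adj; apply: f_adj; rewrite (inj_eq e_inj).
Qed.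

(** * Substar graphs omit the family S *)

Definition cut (T : sgraph) (s t : T) : rel T :=
  fun a b => [&& adj a b, (a, b) != (s, t) & (a, b) != (t, s)].

Lemma cut_sym (T : sgraph) (s t : T) : connect_sym (cut s t).
Proof.
apply: sym_connect_sym => a b; rewrite /cut adj_sym !xpair_eqE; congr (_ && _).
by rewrite andbC [(a == s) && _]andbC [(a == t) && _]andbC.
Qed.

(** A duplicate-free path from [s] to [t] avoiding the edge between them would close up with that
    edge. It has at least two edges, so the result is a genuine cycle. *)
Lemma acyclic_bridge (T : sgraph) (s t : T) :
  acyclic T -> adj s t -> ~~ connect (cut s t) s t.
Proof.
move=> acT st; apply/negP => /connectP[p0 path_p0 def_t].
case/shortenP: path_p0 def_t => p path_p uniq_p _ def_t.
apply: (acT (s :: p)) => //.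
  case: p path_p def_t {uniq_p} => [|a [|b p]] //=.
    by move=> _ def_t; rewrite def_t adj_irrefl in st.
  by rewrite andbT => + def_t; rewrite -def_t /cut eqxx andbF.
apply/andP; split=> //=; rewrite rcons_path -def_t adj_sym st andbT.
by apply: sub_path path_p => a b /and3P[].
Qed.

Definition within (T : sgraph) (A : {set T}) : rel T :=
  fun a b => [&& adj a b, a \in A & b \in A].

Definition convex (T : sgraph) (A : {set T}) : Prop :=
  {in A &, forall a b, connect (within A) a b}.

Lemma connected_convex (T : sgraph) (A : {set T}) :
  connected (induced A) -> convex A.
Proof.
move=> connA a b aA bA; have /connectP[p] := connA (exist _ a aA) (exist _ b bA).
elim: p a aA => [|[c cA] p IHp] a aA /= => [_ [->] // | /andP[ac path_p] def_b].
apply: connect_trans (IHp c cA path_p def_b).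
by apply/connect1/and3P.
Qed.

Lemma convex_cutl (T : sgraph) (A : {set T}) (s t a b : T) :
  convex A -> s \notin A -> a \in A -> b \in A -> connect (cut s t) a b.
Proof.
move=> cA sA aA bA; apply: connect_sub (cA _ _ aA bA) => c d /and3P[cd cA' dA].
apply: connect1; rewrite /cut cd !xpair_eqE /=.
have /negPf->: c != s by apply: contraNneq sA => <-.
by have /negPf->: d != s by [apply: contraNneq sA => <-]; rewrite andbF.
Qed.

Lemma convex_cutr (T : sgraph) (A : {set T}) (s t a b : T) :
  convex A -> t \notin A -> a \in A -> b \in A -> connect (cut s t) a b.
Proof.
move=> cA tA aA bA; apply: connect_sub (convex_cutl s cA tA aA bA) => c d.
by rewrite /cut => cd; apply: connect1; rewrite /cut [X in _ && X]andbC.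
Qed.

(** Helly property of subtrees. Follow a path in [B] from [p] to [q] until an edge [pb] leaves [A].
    If [p] were not in [C], one could go from [p] to [r] in [A], on to [q] in [C], and back to [b]
    along the rest of the path, never using the bridge [pb]. *)
Lemma convex_helly (T : sgraph) (A B C : {set T}) (p q r : T) :
    acyclic T -> convex A -> convex B -> convex C ->
    p \in A -> p \in B -> q \in B -> q \in C -> r \in A -> r \in C ->
  exists t, [/\ t \in A, t \in B & t \in C].
Proof.
move=> acT cA cB cC + pB qB qC rA rC; have /connectP[s0 path_s0 def_q] := cB _ _ pB qB.
case/shortenP: path_s0 def_q => s path_s uniq_s _ def_q {s0}.
elim: s p path_s uniq_s def_q pB => [|b s IHs] p /=.
  by move=> _ _ def_q pB pA; exists q; rewrite {1}def_q.
case/andP=> /and3P[pb _ bB] path_s /andP[p_s uniq_s] def_q pB pA.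
have [bA | bA] := boolP (b \in A); first exact: IHs uniq_s def_q bB bA.
have [pC | pC] := boolP (p \in C); first by exists p.
case/negP: (acyclic_bridge acT pb).
apply: connect_trans (convex_cutr p cA bA pA rA) _.
apply: connect_trans (convex_cutl b cC pC rC qC) _.
rewrite cut_sym; apply/connectP; exists s => //.
apply: (@sub_in_path _ [pred z | z != p]) path_s => [c d cp dp /and3P[cd _ _]|].
  by rewrite /cut cd !xpair_eqE (negPf cp) (negPf dp) andbF.
by apply/allP => z zs; apply: contraNneq p_s => <-.
Qed.

(** A convex set that meets a star in two vertices contains its center: otherwise a walk from [a] to
    [b] inside the set, followed by the edge [bc], would bypass the bridge [ca]. *)
Lemma convex_center (T : sgraph) (A : {set T}) (c a b : T) :
    acyclic T -> convex A -> a \in A -> b \in A -> a != b ->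
    (a != c -> adj c a) -> (b != c -> adj c b) ->
  c \in A.
Proof.
move=> acT cA aA bA ab ca cb; apply/negPn/negP => cNA.
have nc z : z \in A -> z != c by move=> zA; apply: contraNneq cNA => <-.
case/negP: (acyclic_bridge acT (ca (nc a aA))).
rewrite cut_sym; apply: connect_trans (convex_cutl a cA cNA aA bA) _.
apply: connect1; rewrite /cut adj_sym cb ?nc // !xpair_eqE.
by rewrite (negPf (nc b bA)) [b == a]eq_sym (negPf ab).
Qed.

(** * Centers of the stars in a substar representation *)

Definition indep2 (G : sgraph) (x y a b : G) : bool :=
  [&& a != b, ~~ adj a b, adj x a, adj y a, adj x b & adj y b].

Section StarCenters.
Variable (H : sgraph).
Hypothesis starH : substar H.

(** By the Helly property each common neighbour of [x] and [y] yields a node shared by all three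
    stars, and nonadjacent common neighbours yield different nodes. Two such nodes force the center
    of [x] into [f y] by [convex_center]; three leave no room for two different centers. *)
Lemma substar_centers :
  exists T (f : H -> {set T}) (cen : H -> T),
    [/\ forall x y, x != y -> adj x y <-> exists t, t \in f x :&: f y,
        forall x y a b, adj x y -> indep2 x y a b -> cen x \in f y
      & forall x y a b c, adj x y -> indep2 x y a b -> indep2 x y a c ->
          indep2 x y b c -> cen x = cen y].
Proof.
case: starH => T [f [[_ _ acT] star_f f_adj]].
have /fin_all_exists[cen cenP] x :
    exists c, c \in f x /\ forall t, t \in f x -> t != c -> adj c t.
  have [_ [c cP]] := star_f x; exists (val c); split=> [|t tx tc].
    exact: valP c.
  exact: (cP (exist _ t tx)).
have cf x : convex (f x) by case: (star_f x) => -[_ /connected_convex].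
have adjP x y : adj x y -> exists t, t \in f x /\ t \in f y.
  move=> xy; have nxy : x != y by apply: contraTneq xy => ->; rewrite adj_irrefl.
  by have [t /setIP[]] := (f_adj x y nxy).1 xy; exists t.
have triple x y a : adj x y -> adj x a -> adj y a ->
    exists t, [/\ t \in f x, t \in f y & t \in f a].
  move=> /adjP[p [px py]] /adjP[r [rx ra]] /adjP[q [qy qa]].
  exact: (convex_helly acT (cf x) (cf y) (cf a) px py qy qa rx ra).
have sep a b t : a != b -> ~~ adj a b -> t \in f a -> t \in f b -> False.
  by move=> ab /negP nab ta tb; apply/nab/f_adj => //; exists t; apply/setIP.
have F1 x y a b : adj x y -> indep2 x y a b -> cen x \in f y.
  move=> xy /and5P[ab nab xa ya /andP[xb yb]].
  have [t [tx ty ta]] := triple _ _ _ xy xa ya.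
  have [s [sx sy sb]] := triple _ _ _ xy xb yb.
  apply: (@convex_center _ _ _ t s acT (cf y) ty sy); try exact: (cenP x).2.
  by apply/eqP => ts; apply: (sep a b t); rewrite // ts.
exists T, f, cen; split=> // x y a b c xy iab iac ibc; apply/eqP/negPn/negP => nc.
have cxy := F1 _ _ _ _ xy iab.
have cyx : cen y \in f x.
  apply: (F1 y x a b); first by rewrite adj_sym.
  by case/and5P: iab => ? ? ? ? /andP[? ?]; apply/and5P; split=> //; apply/andP.
have [/and5P[ab nab xa ya /andP[xb yb]] /and5P[ac nac _ _ /andP[xc yc]]] := (iab, iac).
have /and5P[bc nbc _ _ _] := ibc.
have [ta [tax tay taa]] := triple _ _ _ xy xa ya.
have [tb [tbx tby tbb]] := triple _ _ _ xy xb yb.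
have [tc [tcx tcy tcc]] := triple _ _ _ xy xc yc.
have tab : ta != tb by apply/eqP => e; apply: (sep a b ta); rewrite ?e // -e.
have tac : ta != tc by apply/eqP => e; apply: (sep a c ta); rewrite ?e // -e.
have tbc : tb != tc by apply/eqP => e; apply: (sep b c tb); rewrite ?e // -e.
(* One of the three distinct shared nodes differs from both centers, and together with them it forms
   a triangle in the tree. *)
have [t [tx ty tnx tny]] :
    exists t, [/\ t \in f x, t \in f y, t != cen x & t != cen y].
  have [ex|nx] := eqVneq ta (cen x); last have [ey|ny] := eqVneq ta (cen y).
  - have [ey|ny] := eqVneq tb (cen y).
      by exists tc; rewrite -ex -ey ![tc == _]eq_sym.
    by exists tb; rewrite -ex [tb == ta]eq_sym.
  - have [ex|nx'] := eqVneq tb (cen x).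
      by exists tc; rewrite -ex -ey ![tc == _]eq_sym.
    by exists tb; rewrite -ey [tb == ta]eq_sym.
  by exists ta.
have a1 : adj (cen x) (cen y) by apply: (cenP x).2; rewrite // eq_sym.
have a2 : adj (cen y) t by apply: (cenP y).2.
have a3 : adj t (cen x) by rewrite adj_sym; apply: (cenP x).2.
apply: (acT [:: cen x; cen y; t]) => //; rewrite /ucycle /= a1 a2 a3 !inE.
by rewrite negb_or nc ![_ == t]eq_sym tnx tny.
Qed.

End StarCenters.

(** The common neighbours w, a of z, x and w, b of z, y put the center of z into the stars of the
    nonadjacent vertices x and y. *)
Lemma H1_not_substar : ~ substar H1.
Proof.
move=> /substar_centers[T [f [cen [f_adj F1 _]]]].
pose o i := inord i : H1.
have [] // : ~ adj (o 1) (o 3) by rewrite /= /sym_rel -val_eqE /= !inordK.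
have F i j : adj (o 5) (o i) -> indep2 (o 5) (o i) (o 0) (o j) -> 
   cen (o 5) \in f (o i) by apply: F1.
apply/f_adj; first by rewrite -val_eqE /= !inordK.
exists (cen (o 5)); apply/setIP; split.
  by apply: (F 1 2); rewrite /indep2 /= /sym_rel -!val_eqE /= !inordK.
by apply: (F 3 4); rewrite /indep2 /= /sym_rel -!val_eqE /= !inordK.
Qed.

(** As for [H1], now with the common neighbours u, a of z, x and v, b of z, y, which are nonadjacent
    in all three types. *)
Lemma H2_not_substar t : ~ substar (H2 t).
Proof.
move=> /substar_centers[T [f [cen [f_adj F1 _]]]].
pose o i := inord i : H2 t.
have [] // : ~ adj (o 1) (o 4).
  by case: t @o {f cen f_adj F1} => o; rewrite /= /sym_rel -val_eqE /= !inordK.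
apply/f_adj; first by rewrite -val_eqE /= !inordK.
exists (cen (o 6)); apply/setIP; split.
  by apply: (F1 _ _ (o 0) (o 2)); case: t @o {f cen f_adj F1} => o;
    rewrite /indep2 /= /sym_rel -!val_eqE /= !inordK.
by apply: (F1 _ _ (o 3) (o 5)); case: t @o {f cen f_adj F1} => o;
  rewrite /indep2 /= /sym_rel -!val_eqE /= !inordK.
Qed.

Lemma H3_adj_cc k (i j : 'I_k.+1) : @adj (H3 k) (inl i) (inl j) =
  (i != j :> nat) && ~~ ((val i == 0) && (val j == k)) &&
  ~~ ((val j == 0) && (val i == k)).
Proof.
rewrite /= /sym_rel /= (_ : (inl i == inl j :> 'I_k.+1 + 'I_k) = (i == j :> nat)) //.
have := ltn_ord i; have := ltn_ord j; case: i j => [i ?] [j ?] /=; lia.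
Qed.

Lemma H3_adj_ca k (i : 'I_k.+1) (j : 'I_k) : @adj (H3 k) (inl i) (inr j) =
  (i == j :> nat) || (i == j.+1 :> nat).
Proof. by rewrite /= /sym_rel /= orbF. Qed.

Lemma H3_adj_aa k (i j : 'I_k) : @adj (H3 k) (inr i) (inr j) = false.
Proof. by rewrite /= /sym_rel /= andbF. Qed.

Lemma H3_not_substar k : 3 <= k -> ~ substar (H3 k).
Proof.
move=> k3 /substar_centers[T [f [cen [f_adj F1 F2]]]].
pose c i : H3 k := inl (inord i).
have [k' def_k] : exists k', k = k'.+1 by exists k.-1; lia.
pose a i : H3 k := inr (cast_ord (esym def_k) (inord i)).
have cc i j : i <= k -> j <= k -> adj (c i) (c j) =
    (i != j) && ~~ ((i == 0) && (j == k)) && ~~ ((j == 0) && (i == k)).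
  by move=> ik jk; rewrite H3_adj_cc /= !inordK.
have ca i j : i <= k -> j < k -> adj (c i) (a j) = (i == j) || (i == j.+1).
  by move=> ik jk; rewrite H3_adj_ca /= !inordK // -def_k.
have ac i j : i <= k -> j < k -> adj (a j) (c i) = (i == j) || (i == j.+1).
  by rewrite adj_sym; apply: ca.
have neq i j : i <= k -> j <= k -> (c i == c j) = (i == j).
  move=> ik jk; rewrite (_ : (c i == c j) = (inord i == inord j :> 'I_k.+1)) //.
  by rewrite -val_eqE /= !inordK.
have neqac i j : (a j == c i) = false by [].
(* Consecutive inner vertices [c i.+1], [c i.+2] have the three pairwise nonadjacent common
   neighbours [a i.+1], [c 0] and [c k]. *)
have eq_cen i : 0 < i -> i < k -> cen (c 1) = cen (c i).
  elim: i => [|[|i] IHi] // _ ik; rewrite IHi //; last by lia.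
  apply: (F2 _ _ (a i.+1) (c 0) (c k));
    rewrite /indep2 ?cc ?ca ?ac ?neq ?neqac //; try lia.
have [] // : ~ adj (c 0) (c k) by rewrite cc; lia.
apply/f_adj; first by rewrite neq; lia.
(* The end edges have two nonadjacent common neighbours each: [a 0], [c 2] at one end and [a k.-1],
   [c 1] at the other. Here [c 2] is adjacent to [c 0] because [k] is at least 3. *)
exists (cen (c 1)); apply/setIP; split.
  by apply: (F1 _ _ (a 0) (c 2)); rewrite /indep2 ?cc ?ca ?ac ?neq ?neqac //; lia.
rewrite (eq_cen k.-1); try lia.
by apply: (F1 _ _ (a k.-1) (c 1)); rewrite /indep2 ?cc ?ca ?ac ?neq ?neqac //; lia.
Qed.

Lemma family_S_not_substar (H : sgraph) : family_S H -> ~ substar H.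
Proof.
case=> [|t|k k3]; first exact: H1_not_substar.
  exact: H2_not_substar.
exact: H3_not_substar.
Qed.

(** * Simplicial vertices of chordal graphs *)

Lemma adj_neq (G : sgraph) (x y : G) : adj x y -> x != y.
Proof. by apply: contraTneq => ->; rewrite adj_irrefl. Qed.

(** The number of edges is recorded because shortest-walk arguments below are inductions on it;
    [connect] forgets it. *)
Definition walk (T : eqType) (e : rel T) n (x y : T) : Prop :=
  exists s, [/\ size s = n, path e x s & last x s = y].

Section Walks.
Variables (T : eqType) (e : rel T).
Implicit Types (x y z : T).

Lemma walk0 x : walk e 0 x x. Proof. by exists [::]. Qed.

Lemma walk1 x y : e x y -> walk e 1 x y.
Proof. by move=> xy; exists [:: y]; rewrite /= xy. Qed.

Lemma walkD m n x y z : walk e m x y -> walk e n y z -> walk e (m + n) x z.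
Proof.
move=> [s [<- ps <-]] [t [<- pt <-]]; exists (s ++ t).
by rewrite size_cat cat_path last_cat ps.
Qed.

(** Indexing the vertices and keeping the lengths of all subwalks makes it easy to splice in a
    shortcut and count the edges of the result. *)
Lemma walk_points n x y : walk e n x y ->
  exists c : nat -> T, [/\ c 0 = x, c n = y &
    forall i j, i <= j -> j <= n -> walk e (j - i) (c i) (c j)].
Proof.
move=> [s [<- ps <-]]; exists (nth x (x :: s)); split=> //.
  by rewrite -[size s]/(size (x :: s)).-1 nth_last.
move=> i j ij; elim: j ij => [|j IHj] ij js.
  by move: ij; rewrite leqn0 => /eqP->; apply: walk0.
have [->|nij] := eqVneq i j.+1; first by rewrite subnn; apply: walk0.
have {}ij : i <= j by rewrite -ltnS ltn_neqAle nij.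
rewrite subSn // -addn1; apply: walkD (IHj ij (ltnW js)) (walk1 _).
exact: (pathP x ps).
Qed.

End Walks.

Lemma connect_walk (T : finType) (e : rel T) x y :
  connect e x y -> exists n, walk e n x y.
Proof. by move=> /connectP[s ps ->]; exists (size s), s. Qed.

Lemma cycle_graph_adj n (i j : 'I_n.+2) : 1 < n ->
  @adj (cycle_graph n.+2) i j =
  [|| j == i.+1 :> nat, i == j.+1 :> nat,
      (i == 0 :> nat) && (j == n.+1 :> nat) |
      (j == 0 :> nat) && (i == n.+1 :> nat)].
Proof.
move=> n1; rewrite /= /sym_rel -!val_eqE /=.
have modS k : k < n.+2 -> k.+1 %% n.+2 = if k == n.+1 then 0 else k.+1.
  by case: eqP => [->|]; [rewrite modnn | move=> ? ?; rewrite modn_small //; lia].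
rewrite !modS ?ltn_ord //; have := ltn_ord i; have := ltn_ord j.
by case: ifP => ?; case: ifP => ?; lia.
Qed.

(** The form in which chordality is applied: an induced path plus an apex seeing only its ends.
    Vertex 0 of the cycle of length [n.+2] is sent to [v], vertex [k.+1] to [c k]. *)
Lemma chordal_no_hole (G : sgraph) (v : G) (c : nat -> G) n :
    chordal G -> 1 < n ->
    (forall i j, i < j -> j <= n -> c i != c j) ->
    (forall i j, i < j -> j <= n -> adj (c i) (c j) = (j == i.+1)) ->
    (forall i, i <= n -> v != c i) ->
    (forall i, i <= n -> adj v (c i) = (i == 0) || (i == n)) ->
  False.
Proof.
move=> chG n1 c_neq c_adj v_neq v_adj; apply: (chG n.+2); first by lia.
pose e (i : cycle_graph n.+2) := if val i is k.+1 then c k else v.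
apply: (@has_induced_embed _ _ e) => [[i i_n] [j j_n]|[i i_n] [j j_n]].
  rewrite /e /= => eij; apply: val_inj => /=.
  case: i j i_n j_n eij => [|i] [|j] // i_n j_n eij.
  - by have := v_neq j; rewrite eij eqxx => /(_ j_n).
  - by have := v_neq i; rewrite eij eqxx => /(_ i_n).
  - have [ij|ij|->//] := ltngtP i j.
    + by have := c_neq _ _ ij; rewrite eij eqxx => /(_ j_n).
    + by have := c_neq _ _ ij; rewrite eij eqxx => /(_ i_n).
rewrite (@cycle_graph_adj n) // /e /=.
case: i j i_n j_n => [|i] [|j] // i_n j_n.
- by rewrite adj_irrefl.
- by rewrite v_adj //; lia.
- by rewrite adj_sym v_adj //; lia.
have [ij|ij|->] := ltngtP i j.
- by rewrite c_adj //; lia.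
- by rewrite adj_sym c_adj //; lia.
by rewrite adj_irrefl; lia.
Qed.

Lemma chordal_C4 (G : sgraph) (a b c d : G) : chordal G ->
  adj a b -> adj b c -> adj c d -> adj d a -> a != c -> b != d ->
  adj a c || adj b d.
Proof.
move=> chG ab bc cd da ac bd; apply/negPn; rewrite negb_or; apply/negP.
case/andP=> /negPf nac /negPf nbd; pose p := nth a [:: a; b; c].
have dc : adj d c by rewrite adj_sym.
have ndb : adj d b = false by rewrite adj_sym.
apply: (@chordal_no_hole G d p 2 chG) => //.
- by case=> [|[|[|i]]] [|[|[|j]]] //= _ _; rewrite ?ac ?adj_neq.
- by case=> [|[|[|i]]] [|[|[|j]]] //= _ _; rewrite ?ab ?bc ?nac.
- by case=> [|[|[|i]]] //= _; rewrite ?(adj_neq da) ?(adj_neq dc) // eq_sym.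
- by case=> [|[|[|i]]] //= _; rewrite ?da ?dc ?ndb.
Qed.

Lemma chordal_C5 (G : sgraph) (a b c d e : G) : chordal G ->
  adj a b -> adj b c -> adj c d -> adj d e -> adj e a ->
  a != c -> b != d -> c != e -> d != a -> e != b ->
  [|| adj a c, adj b d, adj c e, adj d a | adj e b].
Proof.
move=> chG ab bc cd de ea ac bd ce da eb; apply/negPn; rewrite !negb_or.
apply/negP=> /and5P[/negPf nac /negPf nbd /negPf nce /negPf nda /negPf neb].
pose p := nth a [:: a; b; c; d].
have ed : adj e d by rewrite adj_sym.
have nec : adj e c = false by rewrite adj_sym.
have nad : adj a d = false by rewrite adj_sym.
have ad : a != d by rewrite eq_sym.
have ec : e != c by rewrite eq_sym.
apply: (@chordal_no_hole G e p 3 chG) => //.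
- by case=> [|[|[|[|i]]]] [|[|[|[|j]]]] //= _ _; rewrite ?ac ?bd ?ad ?adj_neq.
- by case=> [|[|[|[|i]]]] [|[|[|[|j]]]] //= _ _; rewrite ?ab ?bc ?cd ?nac ?nbd ?nad.
- by case=> [|[|[|[|i]]]] //= _; rewrite ?eb ?ec ?adj_neq.
- by case=> [|[|[|[|i]]]] //= _; rewrite ?ea ?ed ?nec ?neb.
Qed.

Section Dirac.
Variable G : sgraph.
Hypothesis chG : chordal G.

(** A shortest walk from [s] to [s'] in [D] has neither repetitions nor chords, since either would
    shorten it. If [s] and [s'] were nonadjacent, this walk and [v] would form a hole. *)
Lemma chordal_separator (v s s' : G) (D : {set G}) :
    adj v s -> adj v s' -> s != s' ->
    s \in D -> s' \in D ->
    (forall z, z \in D -> (z != v) && (adj v z ==> (z == s) || (z == s'))) ->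
  connect (within D) s s' -> adj s s'.
Proof.
move=> vs vs' ss' sD s'D Dv /connect_walk[n]; apply: contraPT => nss'.
elim/ltn_ind: n => n IHn w; have [c [c0 cn cw]] := walk_points w.
have c_edge i : i < n -> within D (c i) (c i.+1).
  move=> i_n; have := cw i i.+1 (leqnSn i) i_n; rewrite subSnn.
  by move=> [[|a [|? ?]] [] //= _]; rewrite andbT => + <-.
have cD i : i <= n -> c i \in D.
  by case: i => [|i /c_edge/and3P[]//]; rewrite c0.
have w_pre i : i <= n -> walk (within D) i s (c i).
  by move=> i_n; have := cw 0 i; rewrite c0 subn0; apply.
have w_post i : i <= n -> walk (within D) (n - i) (c i) s'.
  by move=> i_n; have := cw i n; rewrite cn; apply.
have c_neq i j : i < j -> j <= n -> c i != c j.
  move=> ij jn; apply/eqP => cij.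
  apply: (IHn (i + (n - j))); first by lia.
  by apply: walkD (w_post j jn); rewrite -cij; apply: w_pre; lia.
have c_adj i j : i < j -> j <= n -> adj (c i) (c j) = (j == i.+1).
  move=> ij jn; apply/idP/eqP => [cij|->]; last first.
    by have /and3P[] := c_edge i (leq_trans ij jn).
  apply/eqP/negPn/negP => nj; apply: (IHn (i + (1 + (n - j)))); first by lia.
  apply: walkD (w_pre i _) (walkD (walk1 _) (w_post j jn)); first by lia.
  by rewrite /within cij !cD //; lia.
have n1 : 1 < n.
  case: n c0 cn c_adj {IHn w cw c_edge cD w_pre w_post c_neq} => [|[|]] //.
    by move=> c0s c0s'; move: ss'; rewrite -c0s c0s' eqxx.
  by move=> c0s c1s /(_ 0 1 isT isT); rewrite c0s c1s (negPf nss').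
apply: (@chordal_no_hole G v c n chG) => //.
  by move=> i i_n; rewrite eq_sym; case/andP: (Dv _ (cD i i_n)).
move=> i i_n; have [->|i0] := posnP i; first by rewrite c0.
have [->|i_n'] := eqVneq i n; first by rewrite cn orbT.
apply/negP => vi; have /andP[_] := Dv _ (cD i i_n); rewrite vi /=.
rewrite -c0 -cn eq_sym (negPf (c_neq 0 i i0 i_n)) (negPf (c_neq i n _ _)) //.
by rewrite ltn_neqAle i_n'.
Qed.

(** Dirac's theorem. Let [C] be the component of [w] among the non-neighbours of [v], and [S] the
    neighbours of [v] attached to [C]. Then [S] is a clique by [chordal_separator]. A vertex of [C]
    that is simplicial in the smaller set [C :|: S] is simplicial in [A], having no other neighbours
    there. *)
Lemma simplicial_avoiding (A : {set G}) (v w : G) :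
    v \in A -> w \in A -> w != v -> ~~ adj v w ->
  exists x, [/\ x \in A, x != v, ~~ adj v x &
    {in A &, forall y z, adj x y -> adj x z -> y != z -> adj y z}].
Proof.
have [n] := ubnP #|A|; elim: n => // n IHn in A v w * => /ltnSE leAn vA wA wv nvw.
pose B := [set z in A | (z != v) && ~~ adj v z].
have wB : w \in B by rewrite inE wA wv.
pose C := [set z | connect (within B) w z].
have wC : w \in C by rewrite inE connect0.
have sCB : {subset C <= B}.
  move=> z; rewrite inE => /connectP[s ps ->].
  by case/lastP: s ps => [//|s u]; rewrite rcons_path last_rcons => /andP[_ /and3P[]].
pose S := [set s in A | adj v s && [exists c in C, adj s c]].
have nbrC c z : c \in C -> z \in A -> adj c z -> (z \in C) || (z \in S).
  move=> cC zA cz; have := sCB c cC; rewrite inE => /and3P[cA cv nvc].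
  have [vz|nvz] := boolP (adj v z).
    rewrite !inE zA vz orbC; apply/orP; left.
    by apply/existsP; exists c; rewrite cC adj_sym.
  have zv : z != v by apply: contraNneq nvc => <-; rewrite adj_sym.
  apply/orP; left; move: cC; rewrite !inE => cC; apply: connect_trans cC _.
  by apply: connect1; rewrite /within cz !inE cA cv nvc zA zv.
have S_clique : {in S &, forall s t, s != t -> adj s t}.
  move=> s t; rewrite !inE => /and3P[sA vs /existsP[c /andP[cC sc]]].
  case/and3P=> tA vt /existsP[d /andP[dC td]] st.
  pose D := C :|: [set s; t].
  apply: (@chordal_separator v s t D) => //; rewrite ?inE ?eqxx ?orbT //.
    move=> z; rewrite !inE; case/orP=> [zC|/orP[]/eqP->].
    - have /sCB : z \in C by rewrite inE.
      by rewrite inE => /and3P[_ -> /negPf->].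
    - by rewrite eq_sym adj_neq // eqxx implybT.
    - by rewrite eq_sym adj_neq // eqxx orbT implybT.
  have sub a b : connect (within B) w a -> connect (within B) a b ->
      connect (within D) a b.
    move=> wa /connectP[p + ->]; elim: p a wa => //= y p IHp a wa /andP[ay py].
    have wy := connect_trans wa (connect1 ay).
    apply: connect_trans (IHp y wy py); apply: connect1.
    by case/and3P: ay => ay _ _; rewrite /within ay !inE wa wy.
  have sc' : within D s c by rewrite /within sc !in_setU cC !inE eqxx orbT.
  have dt' : within D d t.
    by rewrite /within adj_sym td !in_setU dC !inE eqxx !orbT.
  move: cC dC; rewrite !inE => wc wd.
  apply: connect_trans (connect1 sc') (connect_trans _ (connect1 dt')).
  apply: sub => //; apply: connect_trans wd.
  rewrite sym_connect_sym // => a b; rewrite /within adj_sym.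
  by congr (_ && _); rewrite andbC.
pose A' := C :|: S.
have vA' : v \notin A'.
  have vS : v \notin S by rewrite inE adj_irrefl andbF.
  rewrite in_setU negb_or vS andbT; apply/negP => /sCB.
  by rewrite inE eqxx andbF.
have sA'A : {subset A' <= A}.
  by move=> z; rewrite inE => /orP[/sCB|]; rewrite inE => /andP[].
have ltA'n : #|A'| < n.
  apply: leq_trans leAn; apply: proper_card; apply/properP; split.
    exact/subsetP.
  by exists v.
suff [x xC x_simp] : exists2 x, x \in C &
    {in A' &, forall y z, adj x y -> adj x z -> y != z -> adj y z}.
  have := sCB x xC; rewrite inE => /and3P[xA xv nvx].
  exists x; split=> // y z yA zA xy xz.
  by apply: x_simp => //; rewrite inE; apply: (nbrC x).
(* Apply induction away from a non-universal vertex of [S]: the result is not in the clique [S],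
   hence in [C]. If [S] is universal in [A'], use a non-universal vertex of [C] instead; the result
   again avoids [S]. If there is none either, [A'] is a clique and [w] will do. *)
have [/exists_inP[s sS /exists_inP[u uA' /andP[us nsu]]]|all_S] := boolP
    [exists s in S, [exists u in A', (u != s) && ~~ adj s u]].
  have sA' : s \in A' by rewrite inE sS orbT.
  have [x [xA' xs nsx x_simp]] := IHn A' s u ltA'n sA' uA' us nsu.
  exists x => //; move: xA'; rewrite in_setU => /orP[//|xS].
  by case/negP: nsx; apply: S_clique; rewrite // eq_sym.
have S_univ s u : s \in S -> u \in A' -> u != s -> adj s u.
  move=> sS uA' us; apply/negPn/negP => nsu; case/negP: all_S.
  by apply/exists_inP; exists s => //; apply/exists_inP; exists u; rewrite // us.
have [/exists_inP[t tC /exists_inP[u uA' /andP[ut ntu]]]|all_C] := boolP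
    [exists t in C, [exists u in A', (u != t) && ~~ adj t u]].
  have tA' : t \in A' by rewrite inE tC.
  have [x [xA' xt ntx x_simp]] := IHn A' t u ltA'n tA' uA' ut ntu.
  exists x => //; move: xA'; rewrite in_setU => /orP[//|xS].
  by case/negP: ntx; rewrite adj_sym; apply: S_univ; rewrite // eq_sym.
exists w => // y z yA' zA' _ _ yz.
have [yC|] := boolP (y \in C); last first.
  move=> yC; apply: S_univ; rewrite // 1?eq_sym //.
  by move: yA'; rewrite in_setU (negPf yC).
apply/negPn/negP => nyz; case/negP: all_C; apply/exists_inP; exists y => //.
by apply/exists_inP; exists z; rewrite // eq_sym yz.
Qed.

Lemma ex_simplicial (A : {set G}) : A != set0 ->
  exists2 x, x \in A &
    {in A &, forall y z, adj x y -> adj x z -> y != z -> adj y z}.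
Proof.
case/set0Pn=> v vA.
have [/exists_inP[w wA /exists_inP[u uA /andP[uw nwu]]]|all_A] := boolP
    [exists w in A, [exists u in A, (u != w) && ~~ adj w u]].
  by have [x [xA _ _ x_simp]] := simplicial_avoiding wA uA uw nwu; exists x.
exists v => // y z yA zA _ _ yz; apply/negPn/negP => nyz; case/negP: all_A.
by apply/exists_inP; exists y => //; apply/exists_inP; exists z; rewrite // eq_sym yz.
Qed.

End Dirac.

(** * The tree of maximal cliques *)

Section ParentTree.
Variables (W : finType) (root : W) (p : W -> W) (r : W -> nat).
Hypothesis r_p : forall d, d != root -> r (p d) < r d.

(** A tree given by parent pointers: the rank [r], which drops along [p], makes every vertex reach
    the root and excludes cycles. *)
Definition parent_tree : sgraph :=
  mk_graph (fun x y : W => (x != root) && (p x == y)).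

Lemma parent_tree_adj x : x != root -> @adj parent_tree x (p x).
Proof.
move=> xr; rewrite /= /sym_rel xr eqxx /= andbT.
by apply: contraTneq (r_p xr) => <-; rewrite ltnn.
Qed.

Lemma parent_tree_up x y : @adj parent_tree x y -> r y <= r x -> y = p x.
Proof.
rewrite /= /sym_rel => /andP[_ /orP[/andP[_ /eqP//]|/andP[yr /eqP xE]]].
by rewrite -xE leqNgt r_p.
Qed.

(** Both cycle neighbours of a vertex of maximal rank would be its parent, yet they are distinct. *)
Lemma parent_tree_acyclic : acyclic parent_tree.
Proof.
move=> s s2 ucs; have [x0 x0s] : exists x, x \in s.
  by case: s s2 {ucs} => // x s _; exists x; apply: mem_head.
case: (@arg_maxnP _ x0 [in s] r x0s) => x xs x_max.
have [i s' def_s] := rot_to xs.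
have : ucycle (@adj parent_tree) (rot i s) by rewrite rot_ucycle.
have : 2 < size (rot i s) by rewrite size_rot.
have {}x_max y : y \in rot i s -> r y <= r x by rewrite mem_rot; apply: x_max.
rewrite {}def_s in x_max *; case/lastP: s' x_max => [//|s' z] x_max.
case: s' x_max => [//|y s'] x_max _.
rewrite /ucycle /= => /andP[/andP[xy]]; rewrite !rcons_path last_rcons.
case/andP=> _ zx /andP[_ /andP[+ _]]; rewrite mem_rcons inE negb_or.
rewrite (parent_tree_up xy) ?x_max ?inE ?eqxx ?orbT //.
rewrite (_ : z = p x) ?eqxx //; apply: parent_tree_up.
  by rewrite adj_sym.
by apply: x_max; rewrite !inE mem_rcons inE eqxx !orbT.
Qed.

Lemma parent_treeP : tree parent_tree.
Proof.
split; [by apply/card_gt0P; exists root | | exact: parent_tree_acyclic].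
have to_root x : connect (@adj parent_tree) x root.
  have [n] := ubnP (r x); elim: n x => // n IHn x /ltnSE rx.
  have [-> //|xr] := eqVneq x root; apply: connect_trans (IHn (p x) _).
    exact/connect1/parent_tree_adj.
  by apply: leq_trans rx; apply: r_p.
move=> x y; apply: connect_trans (to_root x) _.
by rewrite sym_connect_sym //; apply: adj_sym.
Qed.

End ParentTree.

Lemma star_induced (T : sgraph) (A : {set T}) (c : T) :
  acyclic T -> c \in A -> (forall x, x \in A -> x != c -> adj c x) ->
  star (induced A).
Proof.
move=> acT cA c_adj; pose c' : induced A := exist _ c cA.
have c'_adj (x : induced A) : x != c' -> adj c' x.
  by move=> xc; apply: (c_adj (val x)); rewrite ?(valP x).
split; last by exists c'.
split; first by apply/card_gt0P; exists c'.
  have to_c x : connect (@adj (induced A)) c' x.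
    by have [-> //|/c'_adj/connect1] := eqVneq x c'.
  move=> x y; apply: connect_trans (to_c y).
  by rewrite sym_connect_sym //; apply: adj_sym.
move=> s s2 /andP[cs us]; apply: (acT (map val s)); first by rewrite size_map.
by rewrite /ucycle cycle_map cs (map_inj_uniq val_inj).
Qed.

(** * Maximal cliques, centers and the forest they span *)

Section MaxCliques.
Variable G : sgraph.
Implicit Types (x y v w : G) (A D Z : {set G}).

Definition clique A := [forall x in A, forall y in A, (x != y) ==> adj x y].

Lemma cliqueP A :
  reflect {in A &, forall x y, x != y -> adj x y} (clique A).
Proof.
apply: (iffP forall_inP) => [cA x y xA yA xy|cA x xA].
  by have /forall_inP/(_ y yA)/implyP := cA x xA; apply.
by apply/forall_inP => y yA; apply/implyP; apply: cA.
Qed.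

Definition max_clique D := maxset clique D.

Lemma max_cliqueP D : max_clique D ->
  {in D &, forall x y, x != y -> adj x y}.
Proof. by move/maxsetp/cliqueP. Qed.

(** A fixed choice of a maximal clique above [A]; the default [set0] is reached only when [A] is not
    a clique. *)
Definition extend A : {set G} :=
  odflt set0 [pick D | max_clique D & A \subset D].

Lemma extendP A : clique A -> max_clique (extend A) /\ A \subset extend A.
Proof.
rewrite /extend => cA; case: pickP => [D /andP[maxD AD]|no_ext]; first by split.
by have [D maxD AD] := maxset_exists cA; have := no_ext D; rewrite /max_clique maxD AD.
Qed.

Definition common x y := [set D | [&& max_clique D, x \in D & y \in D]].
Definition weak x y := adj x y && (1 < #|common x y|).
Definition strong x y := adj x y && (2 < #|common x y|).

Lemma common_sym x y : common x y = common y x.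
Proof. by apply/setP => D; rewrite !inE [(x \in D) && _]andbC. Qed.

Lemma weak_sym : symmetric weak.
Proof. by move=> x y; rewrite /weak adj_sym common_sym. Qed.

Lemma strong_sym : symmetric strong.
Proof. by move=> x y; rewrite /strong adj_sym common_sym. Qed.

Lemma strong_weak x y : strong x y -> weak x y.
Proof. by case/andP=> xy /ltnW; rewrite /weak xy. Qed.

Lemma common2 x y D Z :
  D \in common x y -> Z \in common x y -> D != Z -> 1 < #|common x y|.
Proof.
move=> Dc Zc DZ; have <- : #|[set D; Z]| = 2 by rewrite cards2 DZ.
by apply/subset_leq_card/subsetP => E; rewrite in_set2 => /orP[]/eqP->.
Qed.

Lemma common3 x y D1 D2 D3 :
    D1 \in common x y -> D2 \in common x y -> D3 \in common x y ->
    D1 != D2 -> D1 != D3 -> D2 != D3 -> 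
  2 < #|common x y|.
Proof.
move=> c1 c2 c3 n12 n13 n23.
have <- : #|[set D1; D2; D3]| = 3.
  by rewrite -setUA cardsU1 cards2 n23 !inE negb_or n12 n13.
apply/subset_leq_card/subsetP => E.
by rewrite in_setU in_set2 in_set1 => /orP[/orP[]|]/eqP->.
Qed.

(** Depends only on the strong component of [v], so that [center] is constant on components. The
    case [x == u] includes the component itself. *)
Definition linked v :=
  [set x | [exists u, connect strong v u && ((x == u) || weak x u)]].

Hypothesis chG : chordal G.
Hypothesis linked_clique : forall v, clique (linked v).

Definition center v := extend (linked v).

Lemma center_max v : max_clique (center v).
Proof. by have [] := extendP (linked_clique v). Qed.

Lemma weak_center v x : weak x v -> x \in center v.
Proof.
have [_ /subsetP + xv] := extendP (linked_clique v); apply; rewrite inE.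
by apply/existsP; exists v; rewrite connect0 xv orbT.
Qed.

Lemma mem_center v : v \in center v.
Proof.
have [_ /subsetP] := extendP (linked_clique v); apply; rewrite inE.
by apply/existsP; exists v; rewrite connect0 eqxx.
Qed.

Lemma strong_center v w : strong v w -> center v = center w.
Proof.
move=> vw; congr extend; apply/setP => x; rewrite !inE; apply: eq_existsb => u.
by rewrite (same_connect (sym_connect_sym strong_sym) (connect1 vw)).
Qed.

(** The cliques [D] and [Z] make [vw] weak, so each of [v], [w] lies in the center of the other. If
    the two centers and [D] were pairwise different, they would make [vw] strong, and the centers
    would agree. *)
Lemma centers_compatible v w D Z : adj v w ->
    D \in common v w -> Z \in common v w -> D != Z -> D != center v ->
  w \in center v /\ (center w = center v \/ center w = D).
Proof.
move=> vw Dc Zc DZ Dv; have vwW : weak v w by rewrite /weak vw (common2 Dc Zc).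
have wv : w \in center v by apply: weak_center; rewrite weak_sym.
split=> //; have [->|/eqP nwv] := eqVneq (center w) (center v); first by left.
right; apply/eqP/negPn/negP => nwD; apply/nwv/esym/strong_center.
rewrite /strong vw (@common3 v w (center w) (center v) D) //.
- by rewrite inE center_max (weak_center vwW) mem_center.
- by rewrite inE center_max mem_center wv.
- exact/eqP.
- by rewrite eq_sym.
Qed.

Definition meets A D := max_clique D && [exists v in A, v \in D].

Lemma meetsP A v D : v \in A -> max_clique D -> v \in D -> meets A D.
Proof. by move=> vA maxD vD; rewrite /meets maxD; apply/exists_inP; exists v. Qed.

(* Adding the vertices in a perfect elimination order, all the new edges of the
   star of x are pendant: center x is hung below a maximal clique Z containing
   x and its earlier neighbours, the other new cliques below center x. *)
Lemma center_forest A :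
  exists (p : {set G} -> {set G}) (r : {set G} -> nat),
  [/\ forall D, meets A D -> r (p D) < r D /\ (p D = set0 \/ meets A (p D)),
      forall D, ~~ meets A D -> r D = 0
    & forall v D, v \in A -> max_clique D -> v \in D -> D != center v ->
        p D = center v \/ p (center v) = D].
Proof.
have [n] := ubnP #|A|; elim: n => // n IHn in A * => /ltnSE leAn.
have [->|A0] := eqVneq A set0.
  exists (fun=> set0), (fun=> 0).
  have no_meets D : meets set0 D = false.
    by apply/negP => /andP[_ /exists_inP[v]]; rewrite inE.
  by split=> [D|//|v D]; rewrite ?no_meets ?inE.
have [x xA x_simp] := ex_simplicial chG A0.
pose B := A :\ x; have ltBn : #|B| < n by rewrite -ltnS (cardsD1 x) xA in leAn.
have {IHn} [p [r [r_p r0 p_star]]] := IHn B ltBn.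
pose N := [set w in B | adj x w]; pose Z := extend (x |: N).
have [maxZ sZ] : max_clique Z /\ x |: N \subset Z.
  apply: extendP; apply/cliqueP => y z.
  have NA w : w \in N -> [/\ w \in A, w != x & adj x w].
    by rewrite !inE => /andP[/andP[]].
  case/setU1P=> [->|/NA[yA yx xy]] /setU1P[->|/NA[zA zx xz]] //; rewrite ?eqxx //.
    by rewrite adj_sym.
  exact: x_simp.
have xZ : x \in Z by apply: (subsetP sZ); rewrite setU11.
have NZ w : w \in N -> w \in Z by move=> wN; apply: (subsetP sZ); rewrite setU1r.
have BN w D : max_clique D -> x \in D -> w \in B -> w \in D -> w \in N.
  move=> maxD xD wB wD; rewrite inE wB; apply: (max_cliqueP maxD) => //.
  by case/setD1P: wB => wx _; rewrite eq_sym.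
have meets_nbr D : meets B D -> x \in D -> exists w, [/\ w \in N, w \in B & w \in D].
  case/andP=> maxD /exists_inP[w wB wD] xD; exists w; split=> //.
  exact: BN xD wB wD.
have meets_A D : meets A D = meets B D || max_clique D && (x \in D).
  apply/idP/idP=> [/andP[maxD /exists_inP[v vA vD]]|].
    have [vx|vx] := eqVneq v x; first by rewrite -vx maxD vD orbT.
    by rewrite (@meetsP _ v) // in_setD1 vx.
  case/orP=> [/andP[maxD /exists_inP[v /setD1P[_ vA] vD]]|/andP[maxD xD]].
    exact: meetsP vD.
  exact: meetsP xD.
have nmeets0 : ~~ meets B set0.
  by apply/negP => /andP[_ /exists_inP[v _]]; rewrite inE.
(* Without earlier neighbours of [x] there is nothing to attach to, and a new center becomes a child
   of the future root [set0]. *)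
pose c := center x; pose Z0 := if N == set0 then set0 else Z.
have maxc : max_clique c by apply: center_max.
have xc : x \in c by apply: mem_center.
pose p' D := if meets B D then p D else if D == c then Z0 else c.
(* A new [c] is ranked just above its parent [Z0], the other new cliques just above [c]; old ranks
   are kept. *)
pose rc := if meets B c then r c else (r Z0).+1.
pose r' D := if meets B D then r D else if D == c then rc else
  if max_clique D && (x \in D) then rc.+1 else 0.
have r'0 : r' set0 = 0.
  rewrite /r' (negPf nmeets0) inE andbF; case: eqP => // c0.
  by rewrite -c0 inE in xc.
have Z0P : Z0 = set0 \/ Z0 = Z /\ meets B Z.
  rewrite /Z0; have [_|/set0Pn[w wN]] := eqVneq N set0; [by left | right].
  split=> //; apply: (@meetsP _ w) => //; first by move: wN; rewrite inE => /andP[].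
  exact: NZ.
exists p', r'; split=> [D|D|v D vA maxD vD Dc].
- have [BD _|nBD] := boolP (meets B D).
    have [rpD pD] := r_p D BD; rewrite /p' BD; split.
      rewrite [r' D]/r' BD; case: pD => [->|BpD]; last by rewrite /r' BpD.
      by rewrite r'0; apply: leq_ltn_trans rpD.
    by case: pD => [->|BpD]; [left | right; rewrite meets_A BpD].
  rewrite meets_A (negPf nBD) /= => /andP[maxD xD]; rewrite /p' (negPf nBD).
  have [Dc|Dc] := eqVneq D c; last first.
    split; last by right; rewrite meets_A maxc xc orbT.
    rewrite [r' D]/r' (negPf nBD) (negPf Dc) maxD xD /= /r' eqxx /rc.
    by case: (meets B c).
  have r'D : r' D = (r Z0).+1 by rewrite /r' (negPf nBD) Dc eqxx /rc -Dc (negPf nBD).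
  split; last by case: Z0P => [->|[-> BZ]]; [left | right; rewrite meets_A BZ].
  rewrite r'D; case: Z0P => [->|[-> BZ]]; first by rewrite r'0.
  by rewrite /r' BZ.
- rewrite meets_A negb_or => /andP[nBD nD]; rewrite /r' (negPf nBD) (negPf nD).
  by case: eqP nD => // ->; rewrite maxc xc.
have [vx|vx] := eqVneq v x; last first.
  have vB : v \in B by rewrite in_setD1 vx.
  rewrite /p' (meetsP vB maxD vD) (meetsP vB (center_max v) (mem_center v)).
  exact: p_star.
subst v; have [BD|nBD] := boolP (meets B D); last first.
  by left; rewrite /p' (negPf nBD) (negPf Dc).
(* If an earlier neighbour [w] of [x] lies in [D] and in a second clique [E] containing [x], then
   [w] lies in [c] too and its center is [c] or [D]. The required edge is then already there in the
   star of [w]. *)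
have old w E : w \in N -> w \in B -> w \in D -> max_clique E -> x \in E ->
    w \in E -> D != E -> p' D = c \/ p' c = D.
  move=> wN wB wD maxE xE wE DE.
  have xw : adj x w by move: wN; rewrite inE => /andP[].
  have Dxw : D \in common x w by rewrite inE maxD vD.
  have Exw : E \in common x w by rewrite inE maxE xE.
  have [wc cw] := centers_compatible xw Dxw Exw DE Dc.
  rewrite /p' BD (meetsP wB maxc wc); case: cw => [cw|cw].
    by rewrite -[c]cw; apply: p_star; rewrite // cw.
  have [|pc|pD] := p_star w c wB maxc wc; first by rewrite cw eq_sym.
    by right; rewrite pc cw.
  by left; rewrite -pD cw.
have [w [wN wB wD]] := meets_nbr D BD vD.
(* The second clique is [Z] when [D] differs from it. When [D] is [Z], it is [c] if [c] is old; a
   new [c] is a child of [Z] by construction. *)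
have [DZ|DZ] := eqVneq D Z; last by apply: (old w Z) => //; apply: NZ.
have [Bc|nBc] := boolP (meets B c).
  have [u [uN uB uc]] := meets_nbr c Bc xc.
  by apply: (old u c); rewrite // DZ NZ.
right; rewrite /p' (negPf nBc) eqxx DZ /Z0; case: eqP => // N0.
by rewrite N0 inE in wN.
Qed.

(** The nodes of the tree are all vertex sets, rooted at [set0]. Sets that are not nonempty maximal
    cliques become children of the root and belong to no star. The star of [v] consists of the
    maximal cliques containing [v]. *)
Lemma substar_of_linked : substar G.
Proof.
have [p [r [r_p r0 p_star]]] := center_forest setT.
pose p' D := if meets setT D then p D else set0.
(* The shift by one keeps the root strictly below the sets of rank 0 that now hang from it. *)
pose r' D := if D == set0 then 0 else (r D).+1.
have meets0 D : meets setT D -> D != set0.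
  by case/andP=> _ /exists_inP[v _ vD]; apply/set0Pn; exists v.
have r'_p' D : D != set0 -> r' (p' D) < r' D.
  move=> D0; rewrite /r' (negPf D0) /p'; have [TD|_] := boolP (meets setT D).
    by case: ifP => // _; case: (r_p D TD).
  by rewrite eqxx.
pose T := parent_tree set0 p'.
have [T0 connT acT] : tree T := parent_treeP r'_p'.
exists T, (fun v => [set D : {set G} | max_clique D && (v \in D)]); split=> //.
  move=> v; apply: (@star_induced T _ (center v)) => //.
    by rewrite inE center_max mem_center.
  move=> D; rewrite inE => /andP[maxD vD] Dc.
  have TD : meets setT D by apply: meetsP vD.
  have Tc : meets setT (center v) by apply: meetsP (mem_center v); rewrite ?center_max.
  have D0 := meets0 D TD; have c0 := meets0 _ Tc.
  have := @parent_tree_adj _ _ _ _ r'_p' _ c0.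
  have := @parent_tree_adj _ _ _ _ r'_p' _ D0.
  rewrite /p' TD Tc adj_sym.
  by case: (p_star v D) => // ->.
move=> x y xy; split=> [adj_xy|[D]]; last first.
  by rewrite !inE => /andP[/andP[maxD xD] /andP[_ yD]]; apply: (max_cliqueP maxD).
have /extendP[maxD /subsetP sD] : clique [set x; y].
  by apply/cliqueP => a b /set2P[]-> /set2P[]->; rewrite ?eqxx // adj_sym.
by exists (extend [set x; y]); rewrite !inE maxD !sD ?inE ?eqxx ?orbT.
Qed.

End MaxCliques.

(** * Forbidden subgraphs in shortest violations *)

Lemma indep2P (G : sgraph) (x y a b : G) :
  reflect [/\ a != b, ~~ adj a b, adj x a /\ adj y a & adj x b /\ adj y b]
          (indep2 x y a b).
Proof.
apply: (iffP and5P) => [[? ? ? ? /andP[]]|[? ? [? ?] [? ?]]]; split=> //.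
exact/andP.
Qed.

Section WeakStrong.
Variable G : sgraph.
Implicit Types (x y a b : G) (D : {set G}).

Lemma clique3 x y a : adj x y -> adj x a -> adj y a -> clique [set x; y; a].
Proof.
move=> xy xa ya; apply/cliqueP => s t.
by case/setUP=> [/set2P[]|/set1P]-> /setUP[/set2P[]|/set1P]->;
  rewrite ?eqxx // adj_sym.
Qed.

Lemma extend3_common x y a : adj x y -> adj x a -> adj y a ->
  extend [set x; y; a] \in common x y /\ a \in extend [set x; y; a].
Proof.
move=> xy xa ya; have [maxD /subsetP sD] := extendP (clique3 xy xa ya).
by rewrite inE maxD !sD // !inE eqxx ?orbT.
Qed.

Lemma separating_cliques a b (D E : {set G}) : max_clique D -> a \in D -> b \in E ->
  a != b -> ~~ adj a b -> D != E.
Proof.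
move=> maxD aD bE ab; apply: contraNneq => DE; apply: (max_cliqueP maxD) => //.
by rewrite DE.
Qed.

Lemma common_max x y D : D \in common x y -> max_clique D.
Proof. by rewrite inE => /andP[]. Qed.

Lemma weakI x y a b : adj x y -> indep2 x y a b -> weak x y.
Proof.
move=> xy /indep2P[ab nab [xa ya] [xb yb]].
have [cD aD] := extend3_common xy xa ya; have [cE bE] := extend3_common xy xb yb.
rewrite /weak xy; apply: (common2 cD cE).
exact: separating_cliques (common_max cD) aD bE ab nab.
Qed.

Lemma strongI x y a b c : adj x y ->
  indep2 x y a b -> indep2 x y a c -> indep2 x y b c -> strong x y.
Proof.
move=> xy /indep2P[ab nab [xa ya] [xb yb]] /indep2P[ac nac _ [xc yc]].
case/indep2P=> bc nbc _ _.
have [c1 aD] := extend3_common xy xa ya; have [c2 bD] := extend3_common xy xb yb.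
have [c3 cD] := extend3_common xy xc yc.
rewrite /strong xy; apply: (common3 c1 c2 c3).
- exact: separating_cliques (common_max c1) aD bD ab nab.
- exact: separating_cliques (common_max c1) aD cD ac nac.
- exact: separating_cliques (common_max c2) bD cD bc nbc.
Qed.

Lemma max_clique_sub (D E : {set G}) : max_clique D -> clique E -> D \subset E -> D = E.
Proof. by move=> /maxsetP[_ maxD] cE DE; rewrite (maxD E). Qed.

(** A vertex [a] of one clique outside the other has a non-neighbour there by maximality. Strong
    edges have no such analogue with three pairwise nonadjacent vertices: the common neighbourhood
    may be a path on four vertices. *)
Lemma weak_indep2 x y : weak x y -> exists a b, indep2 x y a b.
Proof.
case/andP=> xy /card_gt1P[D [E [cD cE DE]]].
move: cD cE; rewrite !inE => /and3P[maxD xD yD] /and3P[maxE xE yE].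
have /subsetPn[a aD aE] : ~~ (D \subset E).
  by apply: contra DE => /(max_clique_sub maxD (maxsetp maxE))/eqP.
have [/existsP[b /and3P[bE ab nab]]|adj_a] := boolP
    [exists b, [&& b \in E, a != b & ~~ adj a b]]; last first.
  have cEa : clique (a |: E).
    have aP t : t \in E -> adj a t.
      move=> tE; apply/negPn/negP => nat; case/negP: adj_a; apply/existsP; exists t.
      by rewrite tE nat andbT; apply: contraNneq aE => ->.
    apply/cliqueP => s t; case/setU1P=> [->|sE] /setU1P[->|tE].
    - by rewrite eqxx.
    - by move=> _; apply: aP.
    - by move=> _; rewrite adj_sym; apply: aP.
    - exact: (max_cliqueP maxE).
  by case/negP: aE; rewrite (max_clique_sub maxE cEa) ?subsetU1 ?setU11.
have neqE t : t \in E -> t != a by move=> tE; apply: contraNneq aE => <-.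
have xa : adj x a by apply: (max_cliqueP maxD); rewrite ?neqE.
have ya : adj y a by apply: (max_cliqueP maxD); rewrite ?neqE.
exists a, b; apply/indep2P; split=> //; split; apply: (max_cliqueP maxE) => //.
  by apply: contraNneq nab => <-; rewrite adj_sym.
by apply: contraNneq nab => <-; rewrite adj_sym.
Qed.

End WeakStrong.

Lemma edge_graph_induced (G : sgraph) n (E : seq (nat * nat)) (x0 : G) (s : seq G) :
  size s = n ->
  (forall i j, i < j -> j < n -> nth x0 s i != nth x0 s j) ->
  (forall i j, i < j -> j < n ->
     adj (nth x0 s i) (nth x0 s j) = ((i, j) \in E) || ((j, i) \in E)) ->
  has_induced G (edge_graph n E).
Proof.
move=> size_s s_neq s_adj.
apply: (@has_induced_embed _ _ (fun i : edge_graph n E => nth x0 s (val i))).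
  move=> i j eij; apply: val_inj; have [ij|ij|//] := ltngtP (val i) (val j).
    by have := s_neq _ _ ij (ltn_ord j); rewrite eij eqxx.
  by have := s_neq _ _ ij (ltn_ord i); rewrite eij eqxx.
move=> i j; rewrite /= /sym_rel -val_eqE /=.
have [ij|ij|->] := ltngtP (val i) (val j); last by rewrite adj_irrefl.
  by rewrite s_adj.
by rewrite adj_sym s_adj // orbC.
Qed.

(** Distinctness comes from a known inequality, from an edge, or from a third vertex adjacent to
    exactly one of the two. *)
Ltac neq_by_adj :=
  match goal with
  | |- is_true (?p != ?p) => fail 1
  | H : is_true (?p != ?q) |- is_true (?p != ?q) => exact H
  | H : is_true (?p != ?q) |- is_true (?q != ?p) => by rewrite eq_sym
  | H : is_true (adj ?p ?q) |- is_true (?p != ?q) => exact (adj_neq H)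
  | H : is_true (adj ?q ?p) |- is_true (?p != ?q) => by rewrite eq_sym (adj_neq H)
  | H : is_true (adj ?r ?p), K : adj ?r ?q = false |- is_true (?p != ?q) =>
      by apply: contraTneq H => ->; rewrite K
  | H : is_true (adj ?r ?q), K : adj ?r ?p = false |- is_true (?p != ?q) =>
      by apply: contraTneq H => <-; rewrite K
  | H : adj ?p ?q = true |- is_true (?p != ?q) => exact (adj_neq H)
  | H : adj ?r ?p = true, K : adj ?r ?q = false |- is_true (?p != ?q) =>
      by apply: contraTneq H => ->; rewrite K
  | H : adj ?r ?q = true, K : adj ?r ?p = false |- is_true (?p != ?q) =>
      by apply: contraTneq H => <-; rewrite K
  end.

(** * Violations with one inner vertex, in the neighbourhood of [z] *)

Section Local.
Variable G : sgraph.
Hypothesis chG : chordal G.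
Hypothesis noS : ~ (exists H, family_S H /\ has_induced G H).

Lemma no_H1 (a x w y b z : G) :
  adj z a -> adj z x -> adj z w -> adj z y -> adj z b ->
  adj a x -> adj x w -> adj w y -> adj y b ->
  adj a w = false -> adj a y = false -> adj a b = false -> adj x y = false ->
  adj x b = false -> adj w b = false -> False.
Proof.
move=> za zx zw zy zb ax xw wy yb aw ay ab xy xb wb; apply: noS.
exists H1; split; first exact: S_H1.
have [az xz wz yz bz] : [/\ adj a z, adj x z, adj w z, adj y z & adj b z].
  by rewrite ![adj _ z]adj_sym.
have [xa wx yw bym] : [/\ adj x a, adj w x, adj y w & adj b y].
  by split; rewrite adj_sym.
have [wa ya ba] : [/\ adj w a = false, adj y a = false & adj b a = false].
  by split; rewrite adj_sym.
have [yx bx bw] : [/\ adj y x = false, adj b x = false & adj b w = false].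
  by split; rewrite adj_sym.
apply: (@edge_graph_induced _ _ _ z [:: w; x; a; y; b; z]) => //.
  by case=> [|[|[|[|[|[|i]]]]]] [|[|[|[|[|[|j]]]]]] //= _ _; neq_by_adj.
by case=> [|[|[|[|[|[|i]]]]]] [|[|[|[|[|[|j]]]]]] //= _ _;
  rewrite ?xa ?aw ?wa ?xz ?az ?wz ?yz ?bz ?wx ?wy ?xy ?yx ?xb ?wb ?ay ?ab ?yb.
Qed.

Lemma no_H2 t (u x a v y b z : G) :
  adj z u -> adj z x -> adj z a -> adj z v -> adj z y -> adj z b ->
  adj u x -> adj x a -> adj v y -> adj y b ->
  u != a -> v != b ->
  adj u a = false -> adj x y = false -> adj x b = false ->
  adj a y = false -> adj a b = false -> adj v b = false ->
  adj u v = (if t is H2_i then false else true) ->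
  adj v x = (if t is H2_i then false else true) ->
  adj v a = (if t is H2_i then false else true) ->
  adj u y = (if t is H2_iii then true else false) ->
  adj u b = (if t is H2_iii then true else false) -> False.
Proof.
move=> zu zx za zv zy zb ux xa vy yb u_a v_b ua xy xb ay ab vb uv vx va uy ub.
apply: noS; exists (H2 t); split; first exact: S_H2.
have [uz xz az] : [/\ adj u z, adj x z & adj a z] by rewrite ![adj _ z]adj_sym.
have [vz yz bz] : [/\ adj v z, adj y z & adj b z] by rewrite ![adj _ z]adj_sym.
have [xu ax yv bym] : [/\ adj x u, adj a x, adj y v & adj b y].
  by split; rewrite adj_sym.
have [au yx bx] : [/\ adj a u = false, adj y x = false & adj b x = false].
  by split; rewrite adj_sym.
have [ya ba bv] : [/\ adj y a = false, adj b a = false & adj b v = false].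
  by split; rewrite adj_sym.
have := (uv, vx, va, uy, ub); rewrite adj_sym [adj v x]adj_sym [adj v a]adj_sym.
rewrite [adj u y]adj_sym [adj u b]adj_sym => -[[[[vu xv] av] yu] bu].
apply: (@edge_graph_induced _ _ _ z [:: u; x; a; v; y; b; z]) => //.
  case: t uv vx va uy ub vu xv av yu bu => /= uv vx va uy ub vu xv av yu bu;
  by case=> [|[|[|[|[|[|[|i]]]]]]] [|[|[|[|[|[|[|j]]]]]]] //= _ _; neq_by_adj.
case: t uv vx va uy ub vu xv av yu bu => /= uv vx va uy ub vu xv av yu bu;
by case=> [|[|[|[|[|[|[|i]]]]]]] [|[|[|[|[|[|[|j]]]]]]] //= _ _;
  rewrite ?uz ?xz ?az ?vz ?yz ?bz ?ux ?ua ?uv ?uy ?ub ?xa ?xv ?xy ?xb;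
  rewrite ?av ?ay ?ab ?vy ?vb ?yb.
Qed.

Section Link.
Variable z : G.

(** If [a] and [b] were adjacent, the absence of holes of length 4 and 5 would make u, x, a, b, y an
    induced path, which gives [H1] with apex [z]. *)
Lemma private_nonadj (x y a b u : G) :
  adj z x -> adj z y -> adj z a -> adj z b -> adj z u ->
  adj x u -> adj x a -> u != a -> adj u a = false -> adj y b ->
  adj x y = false -> adj a y = false -> adj b x = false -> adj a b = false.
Proof.
move=> zx zy za zb zu xu xa u_a ua yb xy ay bx; apply/negP => ab.
have xb : adj x b = false by rewrite adj_sym.
have yx : adj y x = false by rewrite adj_sym.
have ux : adj u x by rewrite adj_sym.
have bym : adj b y by rewrite adj_sym.
have x_y : x != y by neq_by_adj.
have x_b : x != b by neq_by_adj.
have bu : adj b u = false.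
  by apply/negP => bu; have := chordal_C4 chG ux xa ab bu u_a x_b; rewrite ua xb.
have ub : adj u b = false by rewrite adj_sym.
have uy : adj u y = false.
  apply/negP => uy; have yu : adj y u by rewrite adj_sym.
  have a_y : a != y by neq_by_adj.
  have b_u : b != u by neq_by_adj.
  have y_x : y != x by rewrite eq_sym.
  have := chordal_C5 chG ux xa ab bym yu u_a x_b a_y b_u y_x.
  by rewrite ua xb ay bu yx.
exact: (no_H1 zu zx za zb zy ux xa ab bym ua ub uy xb xy ay).
Qed.

(** If [u] misses [b] or [v], then a, x, u, y and the missed vertex form an induced path, hence
    [H1]. Otherwise type [H2_ii] appears with the two sides exchanged. *)
Lemma shared_P3 (x y a b u v : G) :
  adj z x -> adj z y -> adj z a -> adj z b -> adj z u -> adj z v ->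
  adj x u -> adj x a -> u != a -> adj u a = false ->
  adj y v -> adj y b -> v != b -> adj v b = false ->
  adj x y = false -> adj a y = false -> adj b x = false ->
  adj u y -> adj v x = false -> False.
Proof.
move=> zx zy za zb zu zv xu xa u_a ua yv yb v_b vb xy ay bx uy vx.
have ab := private_nonadj zx zy za zb zu xu xa u_a ua yb xy ay bx.
have av := private_nonadj zx zy za zv zu xu xa u_a ua yv xy ay vx.
have [au ax xb yx] : [/\ adj a u = false, adj a x, adj x b = false & adj y x = false].
  by split; rewrite adj_sym.
have [xv ya ba vy] : [/\ adj x v = false, adj y a = false, adj b a = false & adj v y].
  by split; rewrite adj_sym.
have [ux va] : adj u x /\ adj v a = false by split; rewrite adj_sym.
have [ub|/negbTE ub] := boolP (adj u b); last first.
  exact: (no_H1 za zx zu zy zb ax xu uy yb au ay ab xy xb ub).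
have [uv|/negbTE uv] := boolP (adj u v); last first.
  exact: (no_H1 za zx zu zy zv ax xu uy yv au ay av xy xv uv).
have vu : adj v u by rewrite adj_sym.
exact: (@no_H2 H2_ii v y b u x a z).
Qed.

(** The cases are whether [u] sees [y] and [v] sees [x]. Neither gives [H2_i], exactly one is
    [shared_P3], and both give [H1] or [H2_iii]. *)
Lemma private_P3 (x y a b u v : G) :
  adj z x -> adj z y -> adj z a -> adj z b -> adj z u -> adj z v ->
  adj x u -> adj x a -> u != a -> adj u a = false ->
  adj y v -> adj y b -> v != b -> adj v b = false ->
  adj x y = false -> adj a y = false -> adj b x = false -> False.
Proof.
move=> zx zy za zb zu zv xu xa u_a ua yv yb v_b vb xy ay bx.
have ab := private_nonadj zx zy za zb zu xu xa u_a ua yb xy ay bx.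
have [ba yx xb ya] :
    [/\ adj b a = false, adj y x = false, adj x b = false & adj y a = false].
  by split; rewrite adj_sym.
have [au ax ux vy] : [/\ adj a u = false, adj a x, adj u x & adj v y].
  by split; rewrite adj_sym.
have a_u : a != u by rewrite eq_sym.
have [uy|/negbTE uy] := boolP (adj u y); have [vx|/negbTE vx] := boolP (adj v x).
- have [uv|u_v] := eqVneq u v.
    move: vb vx; rewrite -uv => ub _.
    exact: (no_H1 za zx zu zy zb ax xu uy yb au ay ab xy xb ub).
  have [xv yu] : adj x v /\ adj y u by split; rewrite adj_sym.
  have x_y : x != y by neq_by_adj.
  have uv : adj u v.
    by have := chordal_C4 chG xu uy yv vx x_y u_v; rewrite xy.
  have [ub|/negbTE ub] := boolP (adj u b); last first.
    exact: (no_H1 za zx zu zy zb ax xu uy yb au ay ab xy xb ub).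
  have [va|/negbTE va] := boolP (adj v a); last first.
    have av : adj a v = false by rewrite adj_sym.
    exact: (no_H1 za zx zv zy zb ax xv vy yb av ay ab xy xb vb).
  exact: (@no_H2 H2_iii u x a v y b z).
- exact: (@shared_P3 x y a b u v).
- exact: (@shared_P3 y x b a v u).
have ub := private_nonadj zx zy zu zb za xa xu a_u au yb xy uy bx.
have uv := private_nonadj zx zy zu zv za xa xu a_u au yv xy uy vx.
have av := private_nonadj zx zy za zv zu xu xa u_a ua yv xy ay vx.
have va : adj v a = false by rewrite adj_sym.
exact: (@no_H2 H2_i u x a v y b z).
Qed.

(** The two weak edges supply induced paths u, x, a and v, y, b in the neighbourhood of [z], to
    which [private_P3] applies once [a] misses [y] and [b] misses [x]. *)
Lemma weak_neighbours_adj (x y : G) : weak x z -> weak z y -> x != y -> adj x y.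
Proof.
move=> xz zy x_y; have [zx zy'] : adj z x /\ adj z y.
  by rewrite adj_sym; case/andP: xz; case/andP: zy.
have [u [a]] := weak_indep2 xz; case/indep2P=> u_a /negbTE ua [xu zu] [xa za].
have := weak_indep2 zy; rewrite /indep2.
case=> [v [b]] /indep2P[v_b /negbTE vb [zv yv] [zb yb]].
apply/negPn/negP => /negbTE xy.
have [au bv] : adj a u = false /\ adj b v = false by split; rewrite adj_sym.
have [a_u b_v] : a != u /\ b != v by split; rewrite eq_sym.
have noC4 (s t p q : G) : adj p s -> adj p t -> adj q s -> adj q t -> s != t ->
    adj s t = false -> p != q -> adj p q = false -> False.
  move=> ps pt qs qt s_t st p_q pq.
  have [sq tp] : adj s q /\ adj t p by split; rewrite adj_sym.
  by have := chordal_C4 chG ps sq qt tp p_q s_t; rewrite pq st.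
(* Not both of [u] and [a] see [y], since x, u, y, a would be a hole; one that misses [y] is renamed
   [a']. *)
have [u' [a' [[zu' za' xu' xa'] u_a' ua' ay]]] : exists u' a',
    [/\ [/\ adj z u', adj z a', adj x u' & adj x a'],
         u' != a', adj u' a' = false & adj a' y = false].
  have [ya|ya] := boolP (adj y a); last first.
    by exists u, a; split=> //; rewrite adj_sym; apply: negbTE.
  exists a, u; split=> //; rewrite adj_sym; apply/negP => yu.
  exact: (noC4 u a x y).
have [v' [b' [[zv' zb' yv' yb'] v_b' vb' bx]]] : exists v' b',
    [/\ [/\ adj z v', adj z b', adj y v' & adj y b'],
         v' != b', adj v' b' = false & adj b' x = false].
  have [xb|xb] := boolP (adj x b); last first.
    by exists v, b; split=> //; rewrite adj_sym; apply: negbTE.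
  exists b, v; split=> //; rewrite adj_sym; apply/negP => xv.
  exact: (noC4 v b x y).
exact: (@private_P3 x y a' b' u' v').
Qed.

End Link.
End Local.

(** Nothing is assumed between the vertices [a]: chordality already makes them pairwise
    nonadjacent. *)
Lemma H3_induced (G : sgraph) k (p : nat -> G) : chordal G -> 2 < k ->
    (forall i j, i < j -> j <= k ->
       p i != p j /\ adj (p i) (p j) = ~~ ((i == 0) && (j == k))) ->
    (forall j, j < k -> exists a, forall i, i <= k ->
       a != p i /\ adj (p i) a = (i == j) || (i == j.+1)) ->
  has_induced G (H3 k).
Proof.
move=> chG k3 p_adj a_ex.
have /fin_all_exists[a aP] (j : 'I_k) : exists a, forall i, i <= k ->
    a != p i /\ adj (p i) a = (i == j) || (i == j.+1) by apply: a_ex.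
have p_a i (j : 'I_k) : i <= k -> adj (p i) (a j) = (i == j) || (i == j.+1).
  by move=> ik; have [] := aP j i ik.
have a_neq_p i (j : 'I_k) : i <= k -> a j != p i.
  by move=> ik; have [] := aP j i ik.
have a_neq (i j : 'I_k) : i < j -> a i != a j.
  move=> ij; have := p_a j.+1 j (ltn_ord j); rewrite eqxx orbT.
  by apply: contraTneq => <-; rewrite p_a //; lia.
have a_adj (i j : 'I_k) : i < j -> adj (a i) (a j) = false.
  move=> ij; apply/negP => aa; have jk := ltn_ord j.
  have ik := ltn_ord i.
  (* The hole will be [p s], [a i], [a j], [p j.+1]. The choice [s = i] fails only when the two path
     vertices are the nonadjacent [p 0] and [p k]; then the other neighbour [p 1] of [a 0] is
     taken. *)
  pose s := if (i == 0 :> nat) && (j == k.-1 :> nat) then 1 else i : nat.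
  have [sj pa ap] : [/\ s < j.+1, adj (p s) (a i) & adj (p s) (a j) = false].
    by split; rewrite /s /=; case: ifP => ?; rewrite ?p_a; lia.
  have pp : adj (p j.+1) (p s).
    have [//|_] := p_adj s j.+1 sj; rewrite adj_sym => ->.
    by rewrite /s; case: ifP => ?; lia.
  have aj : adj (a j) (p j.+1) by rewrite adj_sym p_a // eqxx orbT.
  have sa : p s != a j by rewrite eq_sym a_neq_p //; lia.
  have ai : a i != p j.+1 by rewrite a_neq_p.
  have := chordal_C4 chG pa aa aj pp sa ai.
  by rewrite ap adj_sym p_a //; lia.
pose e (t : H3 k) := match t with inl i => p (val i) | inr j => a j end.
apply: (@has_induced_embed _ _ e) => [[i|i] [j|j]|[i|i] [j|j]] /=.
- move=> eij; congr inl; apply: val_inj => /=; have [ij|ij|//] := ltngtP i j.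
    by have [] := p_adj _ _ ij (ltn_ord j); rewrite eij eqxx.
  by have [] := p_adj _ _ ij (ltn_ord i); rewrite eij eqxx.
- by move=> eij; have := a_neq_p i j (ltn_ord i); rewrite -eij eqxx.
- by move=> eij; have := a_neq_p j i (ltn_ord j); rewrite -eij eqxx.
- move=> eij; congr inr; apply: val_inj => /=; have [ij|ij|//] := ltngtP i j.
    by have := a_neq _ _ ij; rewrite eij eqxx.
  by have := a_neq _ _ ij; rewrite eij eqxx.
- rewrite -[sym_rel _ _ _]/(@adj (H3 k) (inl i) (inl j)) H3_adj_cc.
  have := ltn_ord i; have := ltn_ord j; rewrite !ltnS => jk ik.
  have [ij|ij|->] := ltngtP i j; last by rewrite adj_irrefl.
    by have [_ ->] := p_adj _ _ ij jk => /=; lia.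
  by rewrite adj_sym; have [_ ->] := p_adj _ _ ij ik => /=; lia.
- rewrite -[sym_rel _ _ _]/(@adj (H3 k) (inl i) (inr j)) H3_adj_ca.
  by rewrite p_a // -ltnS.
- rewrite -[sym_rel _ _ _]/(@adj (H3 k) (inr i) (inl j)) [RHS]adj_sym H3_adj_ca.
  by rewrite adj_sym p_a // -ltnS.
- rewrite -[sym_rel _ _ _]/(@adj (H3 k) (inr i) (inr j)) H3_adj_aa.
  have [ij|ij|/val_inj->] := ltngtP (val i) (val j); last by rewrite adj_irrefl.
    exact: a_adj.
  by rewrite adj_sym a_adj.
Qed.

Ltac arith :=
  repeat match goal with
  | H : is_true (leq _ _) |- _ => revert H
  | H : is_true (~~ (eq_op ?a _)) |- _ => let _ := constr:(a : nat) in revert H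
  end; clear; lia.

(** * Violations with strong inner edges *)

Section Violations.
Variable G : sgraph.
Hypothesis chG : chordal G.
Implicit Types (x y u w a q : G) (c : nat -> G).

(** Equality is allowed in accordance with [linked], which contains the strong component besides its
    weak neighbours. *)
Definition weak_eq x y := (x == y) || weak x y.

(** Supplies an end vertex of [H3]. Of two nonadjacent common neighbours of [x] and [c 0], one
    misses [c 1], or the edge from [x] to [c 1] would be weak. It misses [y], or a hole of length 4
    arises, and it misses [c j], or that vertex would be weakly joined to [x] through [a] and
    [c 1]. *)
Lemma end_private x y c n :
    x != y -> ~~ adj x y -> 0 < n -> weak x (c 0) ->
    (forall i, i <= n -> adj x (c i)) -> (forall i, i <= n -> adj (c i) y) ->
    (forall i j, i <= n -> j <= n -> i != j -> adj (c i) (c j)) ->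
    (forall j, 0 < j -> j <= n -> ~~ weak x (c j)) ->
  exists a, [/\ adj x a, adj (c 0) a, a != y, ~~ adj a y &
    forall j, 0 < j -> j <= n -> a != c j /\ ~~ adj a (c j)].
Proof.
move=> x_y xy n0 /weak_indep2[p [q ipq]] xc yc cc nweak.
have [p_q pq [xp cp] [xq cq]] := indep2P _ _ _ _ ipq.
have [a [xa ca ac1 nac1]] :
    exists a, [/\ adj x a, adj (c 0) a, a != c 1 & ~~ adj a (c 1)].
  have [p1|p1] := eqVneq p (c 1).
    by exists q; split=> //; rewrite -p1 1?eq_sym // adj_sym.
  have [p1'|p1'] := boolP (adj p (c 1)); last by exists p.
  have [q1|q1] := eqVneq q (c 1); first by exists p; rewrite -q1.
  have [q1'|q1'] := boolP (adj q (c 1)); last by exists q.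
  case/negP: (nweak 1 isT n0); apply: (@weakI _ _ _ p q); first exact: xc.
  by apply/indep2P; rewrite ![adj (c 1) _]adj_sym.
have a_y : a != y by apply: contraNneq nac1 => ->; rewrite adj_sym yc.
exists a; split=> //.
  apply/negP => ay; have yc1 : adj y (c 1) by rewrite adj_sym yc.
  have c1x : adj (c 1) x by rewrite adj_sym xc.
  have := chordal_C4 chG xa ay yc1 c1x x_y ac1.
  by rewrite (negPf xy) (negPf nac1).
move=> j j0 jn; have [->//|j1] := eqVneq j 1.
have cj1 : adj (c j) (c 1) by apply: cc.
split; first by apply: contraNneq nac1 => ->.
apply/negP => aj; case/negP: (nweak j j0 jn); apply: (@weakI _ _ _ a (c 1)).
  exact: xc.
by apply/indep2P; split; rewrite // ?[adj (c j) a]adj_sym //; split=> //; apply: xc.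
Qed.

Hypothesis noS : ~ (exists H, family_S H /\ has_induced G H).

(* The induction hypothesis plays the role of the minimality of a shortest
   violation: it makes all vertices of the path except x and y adjacent. *)
Lemma violation_free n x u w y :
  weak_eq x u -> walk (@strong G) n u w -> weak_eq w y -> x != y -> adj x y.
Proof.
elim/ltn_ind: n => n IHn in x u w y * => xu uw wy x_y.
apply/negPn/negP => nxy.
have st_we s t : strong s t -> weak_eq s t.
  by move/strong_weak; rewrite /weak_eq orbC => ->.
have we_adj s t : weak_eq s t -> s != t -> adj s t.
  by move=> /orP[/eqP->|/andP[]//]; rewrite eqxx.
have we_sym s t : weak_eq s t -> weak_eq t s by rewrite /weak_eq eq_sym weak_sym.
have [n0|n0] := posnP n.
  move: uw; rewrite n0 => -[[|? ?] [] //= _ _ uw]; rewrite -uw in wy.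
  move: (xu) (wy) => /orP[/eqP xu'|xu'].
    by rewrite -xu' => /we_adj/(_ x_y); rewrite (negPf nxy).
  case/orP=> [/eqP uy|uy].
    by move: nxy; rewrite -uy; case/andP: xu' => ->.
  by case/negP: nxy; apply: (weak_neighbours_adj chG noS xu' uy).
have [c [c0 cn cw]] := walk_points uw.
have c_pre i : i <= n -> walk (@strong G) i u (c i).
  by move=> i_n; have := cw 0 i; rewrite c0 subn0; apply.
have c_post i : i <= n -> walk (@strong G) (n - i) (c i) w.
  by move=> i_n; have := cw i n; rewrite cn; apply.
have c_st i : i < n -> strong (c i) (c i.+1).
  move=> i_n; have := cw i i.+1 (leqnSn i) i_n; rewrite subSnn.
  by move=> [[|t [|? ?]] [] //= _]; rewrite andbT => + <-.
have c_we i : i < n -> weak_eq (c i) (c i.+1) by move/c_st/st_we.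
(* Minimality: a vertex weakly joined to a later vertex of the path, but not adjacent to [y], would
   start a shorter violation. *)
have to_y s i : i < n -> weak_eq s (c i.+1) -> s != y -> adj s y.
  by move=> i_n si; apply: (IHn (n - i.+1) _ s (c i.+1) w) => //;
    [arith | apply: c_post].
have to_x s i : i < n -> weak_eq (c i) s -> x != s -> adj x s.
  by move=> i_n si; apply: (IHn i _ x u (c i)) => //; apply/c_pre/ltnW.
have x_neq i : i <= n -> x != c i.
  move=> i_n; apply/eqP => xi; case/negP: nxy.
  have [i_n'|i_n'] := eqVneq i n; first by apply: we_adj; rewrite // xi i_n' cn.
  have {i_n'}i_n : i < n by rewrite ltn_neqAle i_n'.
  by apply: (to_y x i) => //; rewrite xi; apply: c_we.
have y_neq i : i <= n -> c i != y.
  move=> i_n; apply/eqP => yi; case/negP: nxy.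
  case: i i_n yi => [|i] i_n yi; first by apply: we_adj; rewrite // -yi c0.
  by apply: (to_x y i) => //; rewrite -yi; apply: c_we.
have xc i : i <= n -> adj x (c i).
  case: i => [|i] i_n; first by apply: we_adj (x_neq 0 i_n); rewrite c0.
  by apply: (to_x _ i); rewrite ?x_neq ?c_we.
have yc i : i <= n -> adj (c i) y.
  move=> i_n; have [i_n'|i_n'] := eqVneq i n.
    by apply: we_adj (y_neq i i_n); rewrite i_n' cn.
  have {}i_n' : i < n by rewrite ltn_neqAle i_n'.
  by apply: (to_y _ i); rewrite ?y_neq ?c_we.
have cx i : i <= n -> adj (c i) x by move=> i_n; rewrite adj_sym xc.
have c_neq i j : i < j -> j <= n -> c i != c j.
  move=> ij jn; apply/eqP => cij; case/negP: nxy.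
  apply: (IHn (i + (n - j)) _ x u w y) => //; first by arith.
  by apply: walkD (c_post j jn); rewrite -cij; apply: c_pre; arith.
have c_adj i j : i < j -> j <= n -> adj (c i) (c j).
  move=> ij jn; have [->|ij'] := eqVneq j i.+1.
    by have /andP[] : strong (c i) (c i.+1) by apply: c_st; arith.
  apply: (IHn (j.-1 - i.+1) _ _ (c i.+1) (c j.-1)) (c_neq i j ij jn); try arith.
  - by apply: c_we; arith.
  - by apply: cw; arith.
  - by have := c_we j.-1; rewrite prednK; last by [arith]; apply; arith.
have c_adj' i j : i <= n -> j <= n -> i != j -> adj (c i) (c j).
  move=> i_n jn; rewrite neq_ltn => /orP[ij|ji]; first exact: c_adj.
  by rewrite adj_sym; apply: c_adj.
have end_x j : 0 < j -> j <= n -> ~~ weak x (c j).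
  move=> j0 jn; apply: contra nxy => xj.
  by case: j j0 jn xj => // j _ jn xj; apply: (to_y x j); rewrite // /weak_eq xj orbT.
have end_y j : j < n -> ~~ weak (c j) y.
  by move=> jn; apply: contra nxy => yj; apply: (to_x y j); rewrite // /weak_eq yj orbT.
(* A strong chord would be a shortcut. *)
have far i j : i.+1 < j -> j <= n -> ~~ strong (c i) (c j).
  move=> ij jn; apply: contra nxy => cij.
  apply: (IHn (i + (1 + (n - j))) _ x u w y) => //; first by arith.
  by apply: walkD (c_pre i _) (walkD (walk1 cij) (c_post j jn)); arith.
have weak_x : weak x (c 0).
  by move: xu; rewrite /weak_eq -c0 (negPf (x_neq 0 _)).
have weak_y : weak (c n) y.
  by move: wy; rewrite /weak_eq -cn (negPf (y_neq n _)).
have [a0 [xa0 ca0 a0_y a0y a0c]] := end_private x_y nxy n0 weak_x xc yc c_adj' end_x.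
(* The other end is obtained from the reversed path. *)
have [a1 [ya1 ca1 a1_x a1x a1c]] : exists a, [/\ adj y a, adj (c n) a, a != x,
    ~~ adj a x & forall j, j < n -> a != c j /\ ~~ adj a (c j)].
  have [] := @end_private y x (fun i => c (n - i)) n.
  - by rewrite eq_sym.
  - by rewrite adj_sym.
  - by [].
  - by rewrite subn0 weak_sym.
  - by move=> i i_n; rewrite adj_sym yc //; arith.
  - by move=> i i_n; rewrite adj_sym xc //; arith.
  - by move=> i j i_n jn ij; apply: c_adj'; arith.
  - by move=> j j0 jn; rewrite weak_sym; apply: end_y; arith.
  rewrite subn0 => a [ya ca a_x ax ac]; exists a; split=> // j jn.
  by have := ac (n - j); rewrite subKn ?(ltnW jn) //; apply; arith.
(* It is enough to find a common neighbour missing [x] and [y]: if it saw another [c j], then [x],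
   [y] and [a] would make an edge excluded by [far] strong. *)
have mid i : i < n -> exists a, [/\ adj (c i) a, adj (c i.+1) a,
    [/\ a != x, a != y, ~~ adj a x & ~~ adj a y] &
    forall j, j <= n -> j != i -> j != i.+1 -> a != c j /\ ~~ adj a (c j)].
  move=> i_n; have /andP[vw card3] := c_st i i_n.
  set v1 := c i in vw card3 *; set v2 := c i.+1 in vw card3 *.
  have [xv1 xv2] : adj x v1 /\ adj x v2 by split; apply: xc => //; apply: ltnW.
  have [yv1 yv2] : adj v1 y /\ adj v2 y by split; apply: yc => //; apply: ltnW.
  pose L t := adj v1 t && adj v2 t.
  have Lx : L x by rewrite /L ![adj _ x]adj_sym xv1.
  have Ly : L y by rewrite /L yv1.
  (* Two nonadjacent neighbours of [q] in the common link make [q] weakly joined to both [v1] and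
     [v2], so minimality applies towards [x] and towards [y]. *)
  have nonsimplicial q s t : L q -> L s -> L t -> adj q s -> adj q t ->
      s != t -> ~~ adj s t -> (x = q \/ adj x q) /\ (q = y \/ adj q y).
    move=> /andP[q1 q2] /andP[s1 s2] /andP[t1 t2] qs qt st nst.
    have w1 : weak v1 q by apply: (@weakI _ _ _ s t) => //; apply/indep2P.
    have w2 : weak q v2.
      by rewrite weak_sym; apply: (@weakI _ _ _ s t) => //; apply/indep2P.
    split.
      have [->|xq] := eqVneq x q; [by left | right].
      by apply: (to_x q i); rewrite // /weak_eq w1 orbT.
    have [->|yq] := eqVneq q y; [by left | right].
    by apply: (to_y q i); rewrite // /weak_eq w2 orbT.
  have [/existsP[a /and5P[/andP[a1' a2'] ax ay nax nay]]|no_a] := boolP [exists a,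
      [&& L a, a != x, a != y, ~~ adj a x & ~~ adj a y]].
    exists a; split=> // j jn ji ji1.
    have acj : ~~ adj a (c j).
      apply/negP => aj; have [ij|ij|ij] := ltngtP i j.
      - apply: (negP (far i j _ jn)); first by arith.
        have cja : adj (c j) a by rewrite adj_sym.
        by apply: (@strongI _ _ _ x y a); rewrite ?c_adj //; apply/indep2P;
          split; rewrite ?cx ?yc ?(ltnW i_n) // 1?eq_sym // adj_sym.
      - apply: (negP (far j i.+1 _ i_n)); first by arith.
        have cja : adj (c j) a by rewrite adj_sym.
        by apply: (@strongI _ _ _ x y a); rewrite ?c_adj ?(leq_trans ij) //;
          apply/indep2P; split; rewrite ?cx ?yc // 1?eq_sym // adj_sym.
      by rewrite ij eqxx in ji.
    by split=> //; apply: contraNneq nax => ->; rewrite adj_sym xc.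
  (* Otherwise x and y are simplicial in the common link L of v1 and v2, and L
     is covered by their neighbourhoods, so that v1 and v2 have only two common
     maximal cliques A and B. *)
  exfalso.
  pose A := [set t | L t && ((t == x) || adj x t)] :|: [set v1; v2].
  pose B := [set t | L t && ((t == y) || adj y t)] :|: [set v1; v2].
  have cluster_clique z : L z ->
      (forall s t, L s -> L t -> adj z s -> adj z t -> s != t -> adj s t) ->
      clique ([set t | L t && ((t == z) || adj z t)] :|: [set v1; v2]).
    move=> Lz z_simp; apply/cliqueP => s t; rewrite !in_setU !in_set1 !in_set.
    have v2v1 : adj v2 v1 by rewrite adj_sym.
    case/orP=> [/andP[Ls zs]|/orP[]/eqP->]; case/orP=> [/andP[Lt zt]|/orP[]/eqP->];
      rewrite ?eqxx //; try by [case/andP: Lt | case/andP: Ls => *; rewrite adj_sym].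
    case/orP: zs => [/eqP->|zs]; case/orP: zt => [/eqP->|zt]; rewrite ?eqxx //.
      by rewrite adj_sym.
    exact: z_simp.
  have cA : clique A.
    apply: cluster_clique => // s t Ls Lt xs xt st; apply/negPn/negP => nst.
    have [_ [/eqP|]] := nonsimplicial x s t Lx Ls Lt xs xt st nst.
      by rewrite (negPf x_y).
    by rewrite (negPf nxy).
  have cB : clique B.
    apply: cluster_clique => // s t Ls Lt ys yt st; apply/negPn/negP => nst.
    have [[/eqP+|+] _] := nonsimplicial y s t Ly Ls Lt ys yt st nst.
      by rewrite (negPf x_y).
    by rewrite (negPf nxy).
  have [D [cD DA DB]] : exists D, [/\ D \in common v1 v2, D != A & D != B].
    have /card_gt2P[D1 [D2 [D3 [[d1 d2 d3] [n12 n23 n31]]]]] := card3.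
    have [e1|n1] := eqVneq D1 A.
      have [e2|n2] := eqVneq D2 B; last by exists D2; rewrite -e1 [_ == D1]eq_sym.
      by exists D3; rewrite -e1 n31 -e2 [_ == D2]eq_sym.
    have [e1|m1] := eqVneq D1 B; last by exists D1.
    have [e2|n2] := eqVneq D2 A; last by exists D2; rewrite -e1 [_ == D1]eq_sym.
    by exists D3; rewrite -e1 n31 -e2 [_ == D2]eq_sym.
  move: cD; rewrite inE => /and3P[maxD vD1 vD2].
  have escape E z : clique E -> D != E ->
      E = [set t | L t && ((t == z) || adj z t)] :|: [set v1; v2] ->
      exists t, [/\ t \in D, L t, t != z & ~~ adj z t].
    move=> cE DE defE.
    have /subsetPn[t tD] : ~~ (D \subset E).
      by apply: contra DE => /(max_clique_sub maxD cE)/eqP.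
    rewrite defE in_setU in_set in_set2 !negb_or => /andP[+ /andP[tv1 tv2]].
    have Lt : L t.
      by apply/andP; split; apply: (max_cliqueP maxD); rewrite // eq_sym.
    by rewrite Lt /= negb_or => /andP[? ?]; exists t.
  have cover t : L t -> [|| t == x, t == y, adj x t | adj y t].
    move=> Lt; apply/negPn/negP; rewrite !negb_or => /and4P[tx ty xt yt].
    by case/negP: no_a; apply/existsP; exists t; rewrite Lt tx ty ![adj t _]adj_sym xt.
  (* A third clique [D] contains some [d] away from [x] and some [e] away from [y]. By [cover], [e]
     is on the side of [x], so it sees both [x] and [d], which are nonadjacent; then [nonsimplicial]
     puts [e] on the side of [y] after all. *)
  have [d [dD Ld dx xd]] := escape A x cA DA erefl.
  have [e [eD Le ey ye]] := escape B y cB DB erefl.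
  have yd : (d == y) || adj y d by have := cover d Ld; rewrite (negPf dx) (negPf xd).
  have xe : (e == x) || adj x e.
    by have := cover e Le; rewrite (negPf ey) (negPf ye) orbF.
  have e_d : e != d by apply/eqP => ed; move: yd; rewrite -ed (negPf ey) (negPf ye).
  have ed : adj e d by apply: (max_cliqueP maxD).
  case/orP: yd => [/eqP dy|yd]; first by move: ye; rewrite -dy adj_sym ed.
  case/orP: xe => [/eqP ex|xe]; first by move: xd; rewrite -ex ed.
  have ex : adj e x by rewrite adj_sym.
  have x_d : x != d by rewrite eq_sym.
  have [_ [/eqP|]] := nonsimplicial e x d Le Lx Ld ex ed x_d xd.
    by rewrite (negPf ey).
  by rewrite adj_sym (negPf ye).
apply: noS; exists (H3 n.+2); split; first by apply: S_H3; arith.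
(* The whole path x, c_0, ..., c_n, y plays the clique part of [H3], with [x] and [y] as its two
   nonadjacent vertices; it has [n.+3] vertices, whence [k = n.+2]. *)
pose p i := if i is i'.+1 then if i' <= n then c i' else y else x.
apply: (@H3_induced G n.+2 p chG); first by arith.
  move=> [|i] [|j] // ij jn; rewrite /p.
    case: leqP => [jn'|jn']; first by rewrite x_neq // xc //; arith.
    by rewrite x_y (negPf nxy); arith.
  have i_n : i <= n by arith.
  rewrite i_n; case: leqP => [jn'|jn']; first by rewrite c_neq // c_adj.
  by rewrite y_neq // yc.
move=> [|j] jn.
  exists a0 => -[|[|i]] i_n; rewrite /p.
  - by rewrite xa0 eq_sym adj_neq.
  - by rewrite leq0n ca0 eq_sym adj_neq.
  - case: (leqP i.+1 n) => [i_n'|i_n']; last by rewrite a0_y adj_sym (negPf a0y).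
    by have [-> /negPf] := a0c i.+1 isT i_n'; rewrite adj_sym.
have [jn'|jn'] := ltnP j n.
  have [a [caj caj1 [a_x a_y ax ay] ac]] := mid j jn'.
  exists a => -[|i] i_n; rewrite /p; first by rewrite a_x adj_sym (negPf ax).
  case: leqP => [i_n'|i_n']; last by rewrite a_y adj_sym (negPf ay); arith.
  have [->|ij] := eqVneq i j; first by rewrite caj eq_sym adj_neq // eqxx.
  have [->|ij1] := eqVneq i j.+1; first by rewrite caj1 eq_sym adj_neq // eqxx orbT.
  by have [-> /negPf] := ac i i_n' ij ij1; rewrite adj_sym => ->; arith.
have {jn jn'}-> : j = n by arith.
exists a1 => -[|i] i_n; rewrite /p; first by rewrite a1_x adj_sym (negPf a1x).
case: leqP => [i_n'|i_n']; last by rewrite ya1 eq_sym adj_neq //; arith.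
have [->|i_n''] := eqVneq i n; first by rewrite ca1 eq_sym adj_neq // eqxx.
by have [|-> /negPf] := a1c i; [arith | rewrite adj_sym => ->; arith].
Qed.

Lemma linked_is_clique (v : G) : clique (linked v).
Proof.
apply/cliqueP => x y; rewrite !inE.
move=> /existsP[u /andP[vu xu]] /existsP[w /andP[vw yw]].
have /connect_walk[n uw] : connect (@strong G) u w.
  apply: connect_trans vw; rewrite sym_connect_sym //; exact: strong_sym.
by apply: (violation_free xu uw); rewrite /weak_eq eq_sym weak_sym.
Qed.

End Violations.

Theorem theorem2 (G : sgraph) (hG : chordal G) :
  substar G <-> ~ (exists H : sgraph, family_S H /\ has_induced G H).
Proof.
split=> [subG [H [SH GH]]|noS].
  exact: family_S_not_substar SH (substar_induced subG GH).
exact: (substar_of_linked hG (linked_is_clique hG noS)).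
Qed.
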